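(* Let $\mathcal{G}=(V,E)$ be a finite undirected graph with $V=\{1,\dots,d\}$, and let $r$ be the number of vertices of the largest clique of $\mathcal{G}$. There exists an estimator $V_n$ (a function of $n$ i.i.d. samples, defined for every $n$ and not depending on the unknown density) such that for every positive Lipschitz continuous probability density $p$ on $[0,1]^d$ satisfying the Markov property with respect to $\mathcal{G}$, when $V_n$ is evaluated on $n$ i.i.d. samples from $p$, $$\|p-V_n\|_1\in\tilde O_p\big(n^{-1/(2+r)}\big)\quad\text{as }n\to\infty.$$
   Context: The data domain is $[0,1]^d$ with Lebesgue measure; $\|\cdot\|_1$ is the $L^1$ norm on $[0,1]^d$. A density $p$ on $[0,1]^d$ is positive if $p(x)>0$ for all $x\in[0,1]^d$ (for continuous $p$, equivalently, bounded below by a positive constant); it is Lipschitz continuous if for some $L\ge 0$, $|p(x)-p(y)|\le L\|x-y\|_2$ for all $x,y$. A clique is a set of pairwise adjacent vertices. Markov property: a density $p$ of a random vector $X=(X_1,\dots,X_d)$ satisfies the Markov property with respect to $\mathcal{G}$ if for all disjoint $A,B,C\subset\{1,\dots,d\}$ such that every path in $\mathcal{G}$ from $A$ to $B$ passes through $C$, $X_A$ and $X_B$ are conditionally independent given $X_C$. $Z_n\in\tilde O_p(a_n)$ means that for some $k\ge 0$, $Z_n=O_p(a_n(\log n)^k)$, i.e. the sequence $Z_n/(a_n(\log n)^k)$ is bounded in probability. The constants may depend on $p$ and $\mathcal{G}$. *)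

(* Defs.v *)
From HB Require Import structures.
From mathcomp Require Import all_boot all_order all_algebra.
From mathcomp Require Import all_classical all_reals all_analysis.

Set Implicit Arguments.
Unset Strict Implicit.
Unset Printing Implicit Defensive.

Import Order.TTheory GRing.Theory Num.Theory.
Import numFieldNormedType.Exports.

Local Open Scope classical_set_scope.
Local Open Scope ring_scope.

(* R^d is [d.-tuple R] with the product sigma-algebra, and the vertices
   1, ..., d of the graph are the elements of ['I_d]. *)

Section lebesgue_tuple.
Context (R : realType).

Definition tuple_cons (d : nat) (z : measurableTypeR R * d.-tuple R) :
    d.+1.-tuple R :=
  [tuple of (z.1 : R) :: z.2].

Lemma measurable_tuple_cons d :
  measurable_fun [set: measurableTypeR R * d.-tuple R] (@tuple_cons d).
Proof.
apply: (@measurable_cons _ _ _ R (fst : _ -> R) d snd); last first.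
  exact: measurable_snd.
by move=> mT B mB; exact: (@measurable_fst _ _ (measurableTypeR R)).
Qed.

Definition tuple_uncons (d : nat) (t : d.+1.-tuple R) :
    measurableTypeR R * d.-tuple R :=
  (tnth t ord0, [tuple of behead t]).

Lemma measurable_tuple_uncons d :
  measurable_fun [set: d.+1.-tuple R] (@tuple_uncons d).
Proof.
apply/measurable_fun_pair; last exact: measurable_behead.
move=> mT B mB; exact: (@measurable_tnth _ R d.+1 ord0 mT B mB).
Qed.

Section step.
Context (d : nat) (m : {sigma_finite_measure set (d.-tuple R) -> \bar R}).

Definition lebesgue_cons : set (d.+1.-tuple R) -> \bar R :=
  pushforward (@lebesgue_measure R \x m)%E (@tuple_cons d).

Let lebesgue_cons0 : lebesgue_cons set0 = 0%E.
Proof. by rewrite /lebesgue_cons /pushforward preimage_set0 measure0. Qed.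

Let lebesgue_cons_ge0 A : (0 <= lebesgue_cons A)%E.
Proof. by rewrite /lebesgue_cons /pushforward; exact: measure_ge0. Qed.

Let lebesgue_cons_sigma_additive : semi_sigma_additive lebesgue_cons.
Proof.
rewrite /lebesgue_cons; apply: measure_semi_sigma_additive.
exact: measurable_tuple_cons.
Qed.

HB.instance Definition _ := isMeasure.Build _ _ _ lebesgue_cons
  lebesgue_cons0 lebesgue_cons_ge0 lebesgue_cons_sigma_additive.

Lemma lebesgue_cons_sigma_finite : sigma_finite setT lebesgue_cons.
Proof.
have /sigma_finiteP[F [TF ndF Foo]] := sigma_finiteT (@lebesgue_measure R).
have /sigma_finiteP[G [TG ndG Goo]] := sigma_finiteT m.
exists (fun n => @tuple_uncons d @^-1` (F n `*` G n)).
  rewrite -preimage_bigcup (_ : \bigcup_n (F n `*` G n) = setT) ?preimage_setT//.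
  apply/seteqP; split => // -[x t] _.
  have [i _ Fx] : (\bigcup_n F n) x by rewrite -TF.
  have [j _ Gt] : (\bigcup_n G n) t by rewrite -TG.
  exists (maxn i j) => //; split => /=.
  - by move: Fx; exact/subsetPset/ndF/leq_maxl.
  - by move: Gt; exact/subsetPset/ndG/leq_maxr.
move=> k; have [mF Fk] := Foo k; have [mG Gk] := Goo k; split.
  rewrite -[X in measurable X]setTI.
  by apply: measurable_tuple_uncons => //; exact: measurableX.
rewrite /lebesgue_cons /pushforward.
rewrite (_ : _ @^-1` _ = F k `*` G k).
  by rewrite product_measure1E// lte_mul_pinfty// ge0_fin_numE.
have consK z : tuple_uncons (@tuple_cons d z) = z.
  by case: z => x t; congr (_, _); exact/val_inj.
by apply/funext => z; rewrite /preimage /mkset consK.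
Qed.

HB.instance Definition _ :=
  Measure_isSigmaFinite.Build _ _ _ lebesgue_cons lebesgue_cons_sigma_finite.

End step.

Fixpoint lebesgue_tuple (d : nat) :
    {sigma_finite_measure set (d.-tuple R) -> \bar R} :=
  match d return {sigma_finite_measure set (d.-tuple R) -> \bar R} with
  | 0 => \d_([tuple] : 0.-tuple R)
           : {sigma_finite_measure set (0.-tuple R) -> \bar R}
  | d'.+1 => lebesgue_cons (lebesgue_tuple d')
           : {sigma_finite_measure set (d'.+1.-tuple R) -> \bar R}
  end.

Lemma lebesgue_tuple_box d (B : 'I_d -> set R) :
  (forall i, measurable (B i)) ->
  lebesgue_tuple d [set x | forall i, B i (tnth x i)] =
  (\prod_(i < d) @lebesgue_measure R (B i))%E.
Proof.
elim: d B => [|d IH] B mB /=.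
  rewrite big_ord0 diracE mem_set//.
  by case.
rewrite big_ord_recl /= -(IH (fun i => B (lift ord0 i)))//.
have mbox : measurable [set x : d.-tuple R | forall i, B (lift ord0 i) (tnth x i)].
  rewrite (_ : mkset _ = \bigcap_(i in [set: 'I_d])
      (fun x : d.-tuple R => tnth x i) @^-1` B (lift ord0 i)).
    apply: fin_bigcap_measurable; first exact: finite_finset.
    move=> i _; rewrite -[X in measurable X]setTI; exact: measurable_tnth.
  by apply/seteqP; split => x /= Bx i => [_|]; exact: Bx.
rewrite -product_measure1E//; last exact: (mB ord0).
rewrite /lebesgue_cons /pushforward.
congr ((_ \x _)%E _); apply/seteqP; split => -[x t] /= Bx.
  split=> [|i]; first by have := Bx ord0.
  by have := Bx (lift ord0 i); rewrite tnthS.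
case: Bx => B0 Bt i.
case: (unliftP ord0 i) => [j ->|->//].
by rewrite tnthS; exact: Bt.
Qed.

End lebesgue_tuple.

Section densities.
Context (R : realType) (d : nat).
Implicit Types (p f g : d.-tuple R -> R).

Definition cube : set (d.-tuple R) :=
  [set x | forall i, 0 <= tnth x i <= 1].

Definition dist2 (x y : d.-tuple R) : R :=
  Num.sqrt (\sum_(i < d) (tnth x i - tnth y i) ^+ 2).

Definition lipschitz_on_cube p :=
  exists2 L : R, 0 <= L &
    forall x y, cube x -> cube y -> `|p x - p y| <= L * dist2 x y.

Definition positive_on_cube p := forall x, cube x -> 0 < p x.

Definition L1dist f g : \bar R :=
  (\int[lebesgue_tuple R d]_(x in cube) (`|f x - g x|)%:E)%E.

(* The values of [p] outside the cube are irrelevant. That [p] integrates to 1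
   over the cube is the case [A = setT]. *)
Definition has_density (P : probability (d.-tuple R) R) p :=
  forall A : set (d.-tuple R), measurable A ->
    P A = (\int[lebesgue_tuple R d]_(x in A `&` cube) (p x)%:E)%E.

End densities.
Arguments cube {R d}.

Section conditional_independence.
Context (R : realType) (dT : measure_display) (T : measurableType dT).
Context (P : probability T R).

(* [h] is a version of the conditional probability P(E | H), for a
   sub-sigma-algebra [H]. Such an [h] always exists (Radon-Nikodym) and is
   unique up to P-null sets. *)
Definition is_cond_prob (H : set (set T)) (E : set T) (h : T -> R) :=
  [/\ preimage_set_system setT h measurable `<=` H,
      P.-integrable setT (EFin \o h) &
      forall S, H S -> (\int[P]_(x in S) (h x)%:E)%E = P (E `&` S)].

Definition cond_indep (F G H : set (set T)) :=
  forall (E1 E2 : set T) (h1 h2 h12 : T -> R), F E1 -> G E2 ->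
    is_cond_prob H E1 h1 -> is_cond_prob H E2 h2 ->
    is_cond_prob H (E1 `&` E2) h12 ->
    {ae P, forall x, h12 x = h1 x * h2 x}.

End conditional_independence.

Section graph.
Context (d : nat) (e : rel 'I_d).
Implicit Types A B C K : {set 'I_d}.

Definition is_clique K :=
  [forall x in K, forall y in K, (x != y) ==> e x y].

Definition clique_number : nat := \max_(K : {set 'I_d} | is_clique K) #|K|.

Definition separates C A B :=
  forall (x y : 'I_d) (s : seq 'I_d), x \in A -> y \in B ->
    path e x s -> last x s = y -> has (mem C) (x :: s).

End graph.

(* The sigma-algebra generated by X_A = (X_i)_(i in A), where X is the canonical
   random vector on R^d. *)
Definition coord_sigma (R : realType) (d : nat) (A : {set 'I_d}) :
    set (set (d.-tuple R)) :=
  <<s \bigcup_(i in [set` A])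
        preimage_set_system setT (fun x : d.-tuple R => tnth x i) measurable >>.

(* [P] is the law of X; the Markov property of a density is that of the law it
   defines. *)
Definition markov_property (R : realType) (d : nat) (e : rel 'I_d)
    (P : probability (d.-tuple R) R) :=
  forall A B C : {set 'I_d},
    [disjoint A & B]%B -> [disjoint A & C]%B -> [disjoint B & C]%B ->
    separates e C A B ->
    cond_indep P (coord_sigma A) (coord_sigma B) (coord_sigma C).

Section probability.
Context (R : realType) (dO : measure_display) (Omega : measurableType dO).
Context (Pr : probability Omega R).

Definition mutually_independent (d : measure_display) (T : measurableType d)
    (X : nat -> {RV Pr >-> T}) :=
  forall (J : seq nat) (S : nat -> set T), uniq J ->
    (forall i, measurable (S i)) ->
    Pr (\bigcap_(i in [set` J]) (X i @^-1` S i)) =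
    (\prod_(i <- J) Pr (X i @^-1` S i))%E.

Definition iid (d : measure_display) (T : measurableType d)
    (P : probability T R) (X : nat -> {RV Pr >-> T}) :=
  mutually_independent X /\
  forall i A, measurable A -> distribution Pr (X i) A = P A.

(* Only large [n] are considered: the normalisation in [soft_Op] vanishes at
   [n = 0] and, if [k > 0], at [n = 1]. *)
Definition bounded_in_probability (Z : nat -> Omega -> \bar R) :=
  forall eps : R, 0 < eps -> exists2 M : R, 0 < M &
    \forall n \near \oo, (Pr [set w | M%:E < `|Z n w|] <= eps%:E)%E.

Definition soft_Op (Z : nat -> Omega -> \bar R) (a : nat -> R) :=
  exists2 k : R, 0 <= k &
    bounded_in_probability
      (fun n w => (((a n * ln n%:R `^ k)^-1)%:E * Z n w)%E).

End probability.

(* Main.v *)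
(* Let [i] and [j] be non-adjacent. Conditioning on the other coordinates and
   localizing to small boxes turns the Markov property into the cross-ratio
   identity p(s,t) p(s',t') = p(s,t') p(s',t) in the coordinates [i], [j]. By
   Moebius inversion (Hammersley-Clifford), on the grid of mesh 1/M the function
   ln p is then exactly a sum of potentials indexed by the cliques, each
   depending on the coordinates in its clique only. Rounding the potentials to
   multiples of 1/M gives finitely many piecewise constant functions, at most
   (2 M^2 + 1)^(2^d M^r) of them, one of which is within O(1/M) of p in L1. The
   estimator is Yatracos' minimum distance estimator over this family: its error
   is at most a constant times the approximation error plus the largest
   deviation of the empirical measure over the sets {q' < q}, which a Chernoff
   bound and a union bound control by O(log n / M) when M ~ n^(1/(2+r)). *)

Require Import Defs.
From HB Require Import structures.
From mathcomp Require Import all_boot all_order all_algebra.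
From mathcomp Require Import all_classical all_reals all_analysis.
From mathcomp Require Import measurable_realfun.
From mathcomp Require Import ring lra zify.

Set Implicit Arguments.
Unset Strict Implicit.
Unset Printing Implicit Defensive.

Import Order.TTheory GRing.Theory Num.Theory.
Import numFieldNormedType.Exports.

Local Open Scope classical_set_scope.
Local Open Scope ring_scope.

(** * Clique potentials by Moebius inversion *)

(** The cross-ratio identity is needed at points, whereas the Markov property speaks of conditional
    probabilities, which are defined up to null sets. The passage is by contradiction: a strict
    inequality at one point survives an error [eps], hence persists on boxes so small that [p]
    varies by at most [eps] on them. The grid values are those of [p] at the corners of the cells
    and not cell averages: averaging over the conditioning coordinates destroys the product
    structure, while at corners the potentials of non-cliques vanish exactly. The price is a
    Lipschitz error of order 1/M, the order of the rounding. The estimator knows no bound on [ln p].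
    Its potentials range over [[- M, M]], which exceeds any fixed bound for large [n]; since the
    number of levels is polynomial in [M], this costs a logarithm only. The family has
    log-cardinality of order [M^r ln n], so deviations are of order [sqrt (M^r ln n / n)], that is
    [sqrt (ln n) / M] when [n] is about [M^(2+r)]; the proof allows [ln n / M]. *)

Lemma card_set_ord d : #|{set 'I_d}| = (2 ^ d)%N.
Proof. by rewrite -cardsT -finset.powersetT card_powerset cardsT card_ord. Qed.

Section moebius.
Context (R : realType) (d : nat) (T : Type) (o : T).
Implicit Types (K S : {set 'I_d}) (c : {ffun 'I_d -> T})
  (u : {ffun 'I_d -> T} -> R).

Definition fill_out S c : {ffun 'I_d -> T} :=
  [ffun i => if i \in S then c i else o].

Definition update c i a : {ffun 'I_d -> T} :=
  [ffun k => if k == i then a else c k].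

(* [(-1) ^ #|K \ S|] if [S] is a subset of [K], and 0 otherwise. *)
Definition moebius_weight K S : R :=
  \prod_i (if i \in K then (if i \in S then 1 else -1) else (i \notin S)%:R).

(** The canonical potential of [u] at [K] in the Hammersley-Clifford theorem, with [o] as the
    reference state. *)
Definition potential u K c : R :=
  \sum_(S : {set 'I_d}) moebius_weight K S * u (fill_out S c).

(** Exchange the sums: for fixed [S] the weights add up over [K] to a product with one factor per
    vertex, and the factor of a vertex outside [S] is [-1 + 1]. Only the full [S] survives, where
    [fill_out] changes nothing. *)
Lemma sum_potential u c : \sum_(K : {set 'I_d}) potential u K c = u c.
Proof.
have sumE S : \sum_(K : {set 'I_d}) moebius_weight K S = (S == [set: 'I_d]%SET)%:R.
  transitivity (\prod_(i < d) ((if i \in S then 1 else -1) + (i \notin S)%:R : R)).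
    by rewrite bigA_distr; apply: eq_bigl.
  have [->|ST] := eqVneq.
    by rewrite big1// => i _; rewrite finset.in_setT/= addr0.
  have [i iS] : exists i, i \notin S.
    apply/existsP; rewrite -negb_forall; apply: contra ST => /forallP ST.
    by apply/eqP/setP => i; rewrite ST finset.in_setT.
  by rewrite (bigD1 i)//= (negbTE iS) addNr mul0r.
rewrite /potential exchange_big /= (bigD1 [set: 'I_d]%SET)//= [X in _ + X]big1.
  rewrite addr0 -mulr_suml sumE eqxx mul1r.
  by congr u; apply/ffunP => i; rewrite ffunE finset.in_setT.
by move=> S ST; rewrite -mulr_suml sumE (negbTE ST) mul0r.
Qed.

Lemma moebius_weight_norm K S : `|moebius_weight K S| <= 1.
Proof.
rewrite /moebius_weight normr_prod 
  -[leRHS](@big1_eq _ _ *%R _ (index_enum 'I_d) predT).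
apply: ler_prod => i _; rewrite normr_ge0/=; case: (i \in K); case: (i \in S);
  by rewrite /= ?normrN ?normr1 ?normr0 ?ler01.
Qed.

Lemma moebius_weight_eq0 K S i :
  i \in S -> i \notin K -> moebius_weight K S = 0.
Proof.
by move=> iS iK; rewrite /moebius_weight (bigD1 i)//= (negbTE iK) iS mul0r.
Qed.

Lemma potential_bound u (B : R) K c : (forall c', `|u c'| <= B) ->
  `|potential u K c| <= (2 ^ d)%:R * B.
Proof.
move=> uB; apply: le_trans (ler_norm_sum _ _ _) _.
apply: (@le_trans _ _ (\sum_(S : {set 'I_d}) B)).
  apply: ler_sum => S _; rewrite normrM -[leRHS]mul1r.
  by apply: ler_pM => //; exact: moebius_weight_norm.
rewrite sumr_const mulr_natl.
by rewrite card_set_ord.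
Qed.

Lemma potential_local u K c c' : {in K, c =1 c'} ->
  potential u K c = potential u K c'.
Proof.
move=> cc'; apply: eq_bigr => S _.
have [SK|/fintype.subsetPn[i iS iK]] := boolP (S \subset K).
  congr (_ * u _); apply/ffunP => i; rewrite !ffunE.
  by case: ifP => // /(fintype.subsetP SK)/cc'.
by rewrite (moebius_weight_eq0 iS iK) !mul0r.
Qed.

Let toggle i S : {set 'I_d} := [set k | (k \in S) (+) (k == i)].

Let toggle_inj i : injective (toggle i).
Proof.
apply: can_inj (toggle i) _ => S.
by apply/setP => k; rewrite !inE addbK.
Qed.

Let moebius_weight_toggle K S i : i \in K ->
  moebius_weight K (toggle i S) = - moebius_weight K S.
Proof.
move=> iK; rewrite /moebius_weight (bigD1 i)//= [in RHS](bigD1 i)//= -mulNr iK.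
congr (_ * _); first by rewrite inE eqxx addbT; case: (i \in S); rewrite ?opprK.
by apply: eq_bigr => k ki; rewrite inE (negbTE ki) addbF.
Qed.

Let fill_out_toggle S c i : fill_out (toggle i S) c =
  update (fill_out S c) i (if i \in S then o else c i).
Proof.
apply/ffunP => k; rewrite !ffunE inE; case: eqP => [->|_].
  by rewrite addbT; case: (i \in S).
by rewrite addbF.
Qed.

(** For [i] in [K], [toggle i] is an involution that reverses the sign of the weight, and likewise
    for [j]. So four times the potential is a weighted sum of mixed second differences of [u] in the
    directions [i] and [j], and these vanish by hypothesis. *)
Lemma potential_eq0 u K c i j : i \in K -> j \in K -> i != j ->
  (forall c a b, u c + u (update (update c i a) j b) =
                 u (update c i a) + u (update c j b)) ->
  potential u K c = 0.
Proof.
move=> iK jK ij uij.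
pose w := moebius_weight K; pose F S := u (fill_out S c).
have sumE k (G : {set 'I_d} -> R) : k \in K ->
    \sum_S w S * G S = - \sum_S w S * G (toggle k S).
  move=> kK; rewrite (reindex_inj (@toggle_inj k)) -sumrN; apply: eq_bigr => S _.
  by rewrite /w moebius_weight_toggle// mulNr.
have Ei := sumE i F iK; have Ej := sumE j F jK.
have Eij := sumE i (fun S => F (toggle j S)) iK.
have : \sum_S w S * F S - \sum_S w S * F (toggle i S)
     - \sum_S w S * F (toggle j S) + \sum_S w S * F (toggle j (toggle i S)) = 0.
  rewrite -!sumrB -big_split/= big1// => S _.
  have /(_ (fill_out S c) (if i \in S then o else c i)
    (if j \in S then o else c j)) E := uij.
  rewrite /F !fill_out_toggle inE (eq_sym j i) (negbTE ij) addbF; move: E.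
  set a := u _; set b := u _; set e1 := u _; set f := u _ => E.
  rewrite -!mulrBr -mulrDr; apply/eqP; rewrite mulf_eq0; apply/orP; right.
  by apply/eqP; lra.
move: Ei Ej Eij => /=.
rewrite [potential _ _ _](_ : _ = \sum_S w S * F S)//.
set X := \sum_S _; set Y := \sum_S _; set Z := \sum_S _; set W := \sum_S _.
by move: X Y Z W => X Y Z W; lra.
Qed.

End moebius.
(** * Minimum distance selection *)

Section minimum_distance.
Context (R : realType) (C Theta : finType).
Implicit Types (f g : C -> R) (q : Theta -> C -> R) (th : Theta).

Definition l1 f g : R := \sum_c `|f c - g c|.

Lemma l1_triangle f g h : l1 f h <= l1 f g + l1 g h.
Proof.
rewrite /l1 -big_split/=; apply: ler_sum => c _.
by rewrite -[X in `|X| <= _](subrKA (g c)) ler_normD.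
Qed.

Lemma l1C f g : l1 f g = l1 g f.
Proof. by apply: eq_bigr => c _; rewrite distrC. Qed.

Lemma sum_le_l1 (A : pred C) f g :
  `|\sum_(c | A c) f c - \sum_(c | A c) g c| <= l1 f g.
Proof.
rewrite -sumrB; apply: le_trans (ler_norm_sum _ _ _) _.
by rewrite /l1 [leRHS](bigID A)/= lerDl sumr_ge0.
Qed.

(** Scheffe's identity. Both sets are kept, because functions of unequal total mass do not
    contribute equally on them. *)
Lemma l1E f g : l1 f g =
  (\sum_(c | g c < f c) f c - \sum_(c | g c < f c) g c) +
  (\sum_(c | f c < g c) g c - \sum_(c | f c < g c) f c).
Proof.
rewrite -!sumrB [X in X + _]big_mkcond [X in _ + X]big_mkcond -big_split/=.
apply: eq_bigr => c _; have [fg|fg|->] := ltgtP (f c) (g c).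
- by rewrite add0r distrC gtr0_norm// subr_gt0.
- by rewrite addr0 gtr0_norm// subr_gt0.
- by rewrite addr0 subrr normr0.
Qed.

(** The sets [{q z.2 < q z.1}] form the Yatracos class. It contains the Scheffe sets of any two
    members of the family, so deviations on it control [l1] between members. *)
Definition scheffe_dev q f th : R :=
  \big[Num.max/0]_(z : Theta * Theta)
    `|\sum_(c | q z.2 c < q z.1 c) q th c - \sum_(c | q z.2 c < q z.1 c) f c|.

Definition min_distance q (th0 : Theta) f : Theta :=
  [arg min_(th < th0) scheffe_dev q f th]%O.

Lemma scheffe_dev_ge q f th th1 th2 :
  `|\sum_(c | q th2 c < q th1 c) q th c - \sum_(c | q th2 c < q th1 c) f c|
    <= scheffe_dev q f th.
Proof.
exact: (@le_bigmax _ _ _ 0 (fun z : Theta * Theta =>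
  `|\sum_(c | q z.2 c < q z.1 c) q th c - \sum_(c | q z.2 c < q z.1 c) f c|)
  (th1, th2)).
Qed.

(** Here [g] is the truth and [f] the data. Without normalisation a difference on a set is bounded
    by [l1] and not by half of it, whence the factor 5 where densities give 3. *)
Lemma min_distance_l1 q th0 f g th (t : R) : 0 <= t ->
  (forall th1 th2, `|\sum_(c | q th2 c < q th1 c) g c -
                     \sum_(c | q th2 c < q th1 c) f c| <= t) ->
  l1 g (q (min_distance q th0 f)) <= 5 * l1 g (q th) + 4 * t.
Proof.
move=> t0 dev.
set th' := min_distance q th0 f.
have devth : scheffe_dev q f th <= l1 g (q th) + t.
  apply: bigmax_le => [|[th1 th2] _ /=]; first by rewrite addr_ge0// sumr_ge0.
  rewrite -(subrKA (\sum_(c | q th2 c < q th1 c) g c)).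
  by apply: le_trans (ler_normD _ _) _; rewrite lerD// l1C sum_le_l1.
have devth' : scheffe_dev q f th' <= l1 g (q th) + t.
  by rewrite /th' /min_distance; case: arg_minP => // i _ /(_ th isT)/le_trans; exact.
(* Each of the two brackets of [l1E] is at most the deviation of [th] plus that of [th'], both at
   most [l1 g (q th) + t]. *)
have H : l1 (q th) (q th') <= 4 * (l1 g (q th) + t).
  rewrite l1E.
  have := scheffe_dev_ge q f th th th'; have := scheffe_dev_ge q f th' th th'.
  have := scheffe_dev_ge q f th th' th; have := scheffe_dev_ge q f th' th' th.
  by rewrite !ler_norml; lra.
by apply: le_trans (l1_triangle g (q th) _) _; lra.
Qed.

End minimum_distance.

(** * The finite family of piecewise constant Gibbs densities *)

(** One level for each vertex set and each code of a configuration on it. Indexing by all vertex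
    sets keeps this a plain function type, whose cardinality is a power. *)
Local Notation gibbs_param d r m :=
  {ffun {set 'I_d} * {ffun 'I_r -> 'I_m.+1} -> 'I_(2 * m.+1 ^ 2).+1}.

Section gibbs_family.
Context (R : realType) (d : nat) (e : rel 'I_d) (r m : nat).
Local Notation M := m.+1.
Local Notation cell := {ffun 'I_d -> 'I_M}.

(* For [#|K| <= r], [code K c] determines the restriction of [c] to [K]. *)
Definition code (K : {set 'I_d}) (c : cell) : {ffun 'I_r -> 'I_M} :=
  [ffun k : 'I_r => nth ord0 [seq c i | i <- enum K] k].

(** The value [ord0] outside [K] is arbitrary: [decode] is fed to the potential of [K], which sees
    the coordinates in [K] only. *)
Definition decode (K : {set 'I_d}) (v : {ffun 'I_r -> 'I_M}) : cell :=
  [ffun i => odflt ord0 (omap v (insub (index i (enum K))))].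

Lemma codeK (K : {set 'I_d}) c : (#|K| <= r)%N ->
  {in K, decode K (code K c) =1 c}.
Proof.
move=> Kr i iK; rewrite ffunE.
have iK' : i \in enum K by rewrite mem_enum.
have ir : (index i (enum K) < r)%N.
  by rewrite (leq_trans _ Kr)// cardE index_mem.
by rewrite insubT/= ffunE /= (nth_map i) ?nth_index// index_mem.
Qed.

(* The potentials take their values in the grid of mesh [1 / M] on [[- M, M]]. *)
Definition level (j : 'I_(2 * M ^ 2).+1) : R := (j%:R - (M ^ 2)%:R) / M%:R.

Lemma level_approx (y : R) : `|y| <= M%:R ->
  exists j, `|y - level j| <= M%:R^-1.
Proof.
have M0 : 0 < M%:R :> R by rewrite ltr0n.
rewrite ler_norml => /andP[ym yM].
have z0 : 0 <= M%:R * (y + M%:R) by rewrite pmulr_rge0// -lerBlDr sub0r.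
have /andP[k1 k2] := truncn_itv z0.
(* At [y = M] the truncation reaches [2 * M ^ 2], hence the successor in the number of levels. *)
have kN : (Num.truncn (M%:R * (y + M%:R)) < (2 * M ^ 2).+1)%N.
  rewrite ltnS -(ler_nat R); apply: le_trans k1 _.
  by rewrite natrM natrX expr2 mulrCA ler_pM2l// mulr_natl mulr2n lerD2r.
exists (Ordinal kN); rewrite /level/= natrX.

have -> : y - ((Num.truncn (M%:R * (y + M%:R)))%:R - M%:R ^+ 2) / M%:R =
   (M%:R * (y + M%:R) - (Num.truncn (M%:R * (y + M%:R)))%:R) / M%:R.
  by field; rewrite gt_eqF.
rewrite normrM [X in _ * X]gtr0_norm ?invr_gt0// ger_pMl ?invr_gt0//.
by rewrite ger0_norm ?subr_ge0// lerBlDl natr1 ltW.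
Qed.

(** There is no normalising constant: minimum distance selection does not require the candidates to
    have mass 1. *)
Definition gibbs (th : gibbs_param d r m) (c : cell) : R :=
  expR (\sum_(K : {set 'I_d} | is_clique e K) level (th (K, code K c))).

Lemma card_gibbs_param :
  #|{: gibbs_param d r m}| = ((2 * M ^ 2).+1 ^ (2 ^ d * M ^ r))%N.
Proof.
rewrite card_ffun card_prod card_ffun !card_ord.
by rewrite card_set_ord.
Qed.

Hypothesis clique_r : forall K, is_clique e K -> (#|K| <= r)%N.

(** At most [2 ^ d] potentials are rounded, each with error at most [1 / M]. The bound on [u] keeps
    every potential within the range of [level]. *)
Lemma gibbs_approx (u : cell -> R) :
  (forall (i j : 'I_d) c a b, i != j -> ~~ e i j ->
    u c + u (update (update c i a) j b) = u (update c i a) + u (update c j b)) ->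
  (forall c, `|u c| <= M%:R / (2 ^ d)%:R) ->
  exists th, forall c, `|u c - ln (gibbs th c)| <= (2 ^ d)%:R / M%:R.
Proof.
move=> u4 uM.
pose phi := potential ord0 u.
have phiM K c : `|phi K c| <= M%:R.
  apply: le_trans (potential_bound _ _ _ uM) _.
  by rewrite mulrCA divff ?mulr1// pnatr_eq0 -lt0n expn_gt0.
have phi0 (K : {set 'I_d}) c : ~~ is_clique e K -> phi K c = 0.
  rewrite negb_forall => /existsP[i]; rewrite negb_imply => /andP[iK].
  rewrite negb_forall => /existsP[j]; rewrite negb_imply => /andP[jK].
  rewrite negb_imply => /andP[ij eij].
  by apply: (potential_eq0 _ _ iK jK ij) => c' a b; exact: u4.
have /choice[th th_phi] : forall z : {set 'I_d} * {ffun 'I_r -> 'I_M},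
    exists j, `|phi z.1 (decode z.1 z.2) - level j| <= M%:R^-1.
  by move=> z; exact: level_approx.
exists [ffun z => th z] => c.
rewrite /gibbs expRK -(sum_potential ord0 u c) -/phi.
rewrite (bigID (is_clique e))/= [X in _ + X - _]big1 => [|K]; last exact: phi0.
rewrite addr0 -sumrB; apply: le_trans (ler_norm_sum _ _ _) _.
apply: (@le_trans _ _ (\sum_(K : {set 'I_d}) M%:R^-1)).
  rewrite [leRHS](bigID (is_clique e))/= ler_wpDr ?sumr_ge0//.
  apply: ler_sum => K cK; rewrite ffunE; have /= := th_phi (K, code K c).
  rewrite [phi K _](_ : _ = phi K c)//; apply: potential_local => i iK.
  by rewrite codeK// clique_r.
by rewrite sumr_const [leRHS]mulr_natl card_set_ord lexx.
Qed.

End gibbs_family.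

(** * Events and integrals of maps with finitely many values *)

Section finite_valued.
Context (R : realType) (dT : measure_display) (T : measurableType dT)
  (mu : {measure set T -> \bar R}) (F : finType) (h : T -> F).
Hypothesis mh : forall f, measurable [set x | h x = f].

Lemma measurable_finite_preimage (Q : F -> Prop) : measurable [set x | Q (h x)].
Proof.
rewrite (_ : mkset _ = \bigcup_(f in [set f | Q f]) [set x | h x = f]).
  by apply: fin_bigcup_measurable => //; exact: finite_finset.
apply/seteqP; split => x /= => [Qx|[f /= Qf ->]//].
by exists (h x).
Qed.

Lemma measurable_fun_finite dU (U : measurableType dU) (g : F -> U) :
  measurable_fun setT (g \o h).
Proof.
by move=> _ B mB; rewrite setTI; exact: (measurable_finite_preimage (g @^-1` B)).
Qed.

Lemma measure_finite_preimage (A : set T) (Q : pred F) : measurable A ->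
  mu (A `&` [set x | Q (h x)]) = (\sum_(f | Q f) mu (A `&` [set x | h x = f]))%E.
Proof.
move=> mA.
rewrite (_ : _ `&` _ =
    \bigcup_(f in [set` Q]) (A `&` [set x | h x = f])); last first.
  apply/seteqP; split => x /= => [[Ax Qx]|[f /= Qf [Ax ->]]//].
  by exists (h x).
apply: etrans (measure_fin_bigcup _ _ _ _) _.
- exact: finite_finset.
- by move=> f g _ _ [x [[_ /= <-] [_ /= <-]]].
- by move=> f _; exact: measurableI.
apply/esym/bigfs => [|f _]; first exact: index_enum_uniq.
by rewrite mem_index_enum.
Qed.

Lemma integral_finite_valued (A : set T) (G : F -> R) : measurable A ->
  (forall f, 0 <= G f) ->
  (\int[mu]_(x in A) (G (h x))%:E =
   \sum_f (G f)%:E * mu (A `&` [set x | h x = f]))%E.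
Proof.
move=> mA G0.
have AE : A = \big[setU/set0]_(f <- index_enum F) (A `&` [set x | h x = f]).
  rewrite -big_distrr/=; apply/seteqP; split => x; last by case.
  move=> Ax; split => //; rewrite -bigcup_seq; exists (h x) => //=.
  exact: mem_index_enum.
rewrite {1}AE ge0_integral_bigsetU//=.
- apply: eq_bigr => f _; rewrite -integral_cst; last exact: measurableI.
  by apply: eq_integral => x; rewrite inE => -[_ /= ->].
- by move=> f; exact: measurableI.
- exact: index_enum_uniq.
- by move=> f g _ _ [x [[_ /= <-] [_ /= <-]]].
- by apply: (measurable_funS measurableT) => //;
    exact: (measurable_fun_finite (fun f => (G f)%:E)).
- by move=> x _; rewrite lee_fin.
Qed.

End finite_valued.

Lemma measure_exists_le (R : realType) (dT : measure_display)
    (T : measurableType dT) (mu : {measure set T -> \bar R}) (F : finType)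
    (A : F -> set T) : (forall f, measurable (A f)) ->
  (mu [set x | exists f, A f x] <= \sum_f mu (A f))%E.
Proof.
move=> mA.
have -> : [set x | exists f, A f x] = \big[setU/set0]_(f <- index_enum F) A f.
  rewrite -bigcup_seq; apply/seteqP; split => x /= => [[f Afx]|[f _ Afx]].
    by exists f => //=; exact: mem_index_enum.
  by exists f.
elim: (index_enum F) => [|f s IH]; first by rewrite !big_nil measure0.
rewrite !big_cons; apply: le_trans (measureU2 _ _ _) _ => //.
  exact: bigsetU_measurable.
by rewrite leeD2l.
Qed.

(** * A Chernoff bound for empirical frequencies *)

Section chernoff.
Context (R : realType).

(** From [expR (- x) >= 1 - x] follows [expR x <= 1 / (1 - x)], which is at most the quadratic for
    [x <= 1/2], negative [x] included. *)
Lemma expR_le_quadratic (x : R) : x <= 2^-1 -> expR x <= 1 + x + 2 * x ^+ 2.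
Proof.
move=> x2.
have x1 : 0 < 1 - x by lra.
have : expR x * (1 - x) <= 1.
  by rewrite -[leRHS](expRxMexpNx_1 x) ler_pM2l ?expR_gt0// expR_ge1Dx.
rewrite -ler_pdivlMr// => /le_trans; apply.
rewrite ler_pdivrMr//.
have -> : (1 + x + 2 * x ^+ 2) * (1 - x) = 1 + x ^+ 2 * (1 - 2 * x) by ring.
by rewrite lerDl mulr_ge0 ?sqr_ge0//; lra.
Qed.

(** The variable is centred, so the linear terms of the quadratic bounds cancel and
    [1 + 2 * l ^+ 2 * (p * (1 - p))] remains. *)
Lemma bernoulli_mgf (p l : R) : 0 <= p <= 1 -> `|l| <= 2^-1 ->
  p * expR (l * (1 - p)) + (1 - p) * expR (l * (0 - p)) <= expR (2 * l ^+ 2).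
Proof.
move=> /andP[p0 p1] l2.
have half a : `|a| <= 1 -> l * a <= 2^-1.
  move=> a1; apply: le_trans (ler_norm _) _.
  by rewrite normrM -[leRHS]mulr1 ler_pM.
have H1 : expR (l * (1 - p)) <= 1 + l * (1 - p) + 2 * (l * (1 - p)) ^+ 2.
  by apply: expR_le_quadratic; apply: half; rewrite ler_norml; apply/andP; split; lra.
have H0 : expR (l * (0 - p)) <= 1 + l * (0 - p) + 2 * (l * (0 - p)) ^+ 2.
  by apply: expR_le_quadratic; apply: half; rewrite ler_norml; apply/andP; split; lra.
apply: le_trans (expR_ge1Dx _).
have q0 : 0 <= 1 - p by lra.
apply: le_trans (lerD (ler_wpM2l p0 H1) (ler_wpM2l q0 H0)) _.
have -> : p * (1 + l * (1 - p) + 2 * (l * (1 - p)) ^+ 2) +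
  (1 - p) * (1 + l * (0 - p) + 2 * (l * (0 - p)) ^+ 2) =
  1 + 2 * l ^+ 2 * (p * (1 - p)) by ring.
have l0 : 0 <= 2 * l ^+ 2 by rewrite mulr_ge0 ?sqr_ge0.
by rewrite lerD2l ler_piMr//; nra.
Qed.

(** Markov's inequality for the exponential moment, as a finite sum: the sum over outcomes of a
    product factors into [n] equal one-variable sums. The sign of [l] is free, so that both tails
    are instances. *)
Lemma bernoulli_tail (n : nat) (p t l : R) : 0 <= p <= 1 -> `|l| <= 2^-1 ->
  \sum_(f : {ffun 'I_n -> bool} | n%:R * t < l * \sum_i ((f i)%:R - p))
    \prod_i (if f i then p else 1 - p)
  <= expR (2 * l ^+ 2 - t) ^+ n.
Proof.
move=> p01 l2; have /andP[p0 p1] := p01.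
pose g (f : {ffun 'I_n -> bool}) : R := \prod_i (if f i then p else 1 - p).
have g0 f : 0 <= g f by apply: prodr_ge0 => i _; case: ifP => _; lra.
pose G (f : {ffun 'I_n -> bool}) : R :=
  g f * (expR (l * \sum_i ((f i)%:R - p)) * expR (- (n%:R * t))).
have G0 f : 0 <= G f by rewrite !mulr_ge0// expR_ge0.
apply: (@le_trans _ _ (\sum_f G f)).
  rewrite [leRHS](bigID (fun f : {ffun 'I_n -> bool} =>
    n%:R * t < l * \sum_i ((f i)%:R - p)))/= ler_wpDr ?sumr_ge0//.
  apply: ler_sum => f tf; rewrite -/(g f) /G -[leLHS]mulr1 ler_wpM2l//.
  rewrite -expRD; apply: le_trans (expR_ge1Dx _).
  by rewrite lerDl subr_ge0 ltW.
have GE f : G f = (\prod_i ((if f i then p else 1 - p) *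
    expR (l * ((f i)%:R - p)))) * expR (- (n%:R * t)).
  by rewrite /G /g mulrA mulr_sumr expR_sum -big_split.
under eq_bigr do rewrite GE.
rewrite -mulr_suml.
rewrite -(bigA_distr_bigA (fun (_ : 'I_n) (b : bool) =>
  (if b then p else 1 - p) * expR (l * (b%:R - p)))).
rewrite prodr_const card_ord big_bool/=.
have -> : expR (2 * l ^+ 2 - t) ^+ n = expR (2 * l ^+ 2) ^+ n * expR (- (n%:R * t)).
  by rewrite -mulrN (expRM_natl n) -exprMn -expRD.
rewrite ler_wpM2r ?expR_ge0//.
rewrite lerXn2r ?nnegrE ?expR_ge0//; last exact: bernoulli_mgf.
by rewrite addr_ge0// mulr_ge0 ?expR_ge0//; lra.
Qed.

Context (dO dT : measure_display) (Omega : measurableType dO)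
  (T : measurableType dT) (Pr : probability Omega R) (P : probability T R)
  (X : nat -> {RV Pr >-> T}).

(** Events about the sample become sets of outcomes in a finite type, whose probabilities are
    explicit products by independence. *)
Definition pattern (b : pred T) n (w : Omega) : {ffun 'I_n -> bool} :=
  [ffun i : 'I_n => b (X i w)].

Lemma measurable_pattern (b : pred T) n (f : {ffun 'I_n -> bool}) :
  measurable [set x | b x] -> measurable [set w | pattern b n w = f].
Proof.
move=> mb.
have -> : [set w | pattern b n w = f] = \bigcap_(i in [set: 'I_n])
    (X i @^-1` (if f i then [set x | b x] else ~` [set x | b x])).
  apply/seteqP; split => w /=.
    by move=> <- i _ /=; rewrite ffunE; case: ifP => /= [|/negbT/negP].
  move=> H; apply/ffunP => i; rewrite ffunE.
  by have /= := H i I; case: (f i) => //= /negP/negbTE.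
apply: fin_bigcap_measurable; first exact: finite_finset.
move=> i _; rewrite -[X in measurable X]setTI.
by apply: measurable_funP => //; case: ifP => // _; exact: measurableC.
Qed.

Hypothesis iidX : iid P X.

Lemma pattern_prob (b : pred T) n (f : {ffun 'I_n -> bool}) :
  measurable [set x | b x] ->
  Pr [set w | pattern b n w = f] =
  (\prod_i (if f i then fine (P [set x | b x])
            else 1 - fine (P [set x | b x])))%:E.
Proof.
move=> mb; have [indX lawX] := iidX.
(* [mutually_independent] asks for sets indexed by all naturals; [setT] fills the indices beyond the
   sample. *)
pose S k := if (insub k : option 'I_n) is Some i then
  if f i then [set x | b x] else ~` [set x | b x] else setT.
have mS k : measurable (S k).
  rewrite /S; case: insub => // i; case: ifP => // _; exact: measurableC.
have -> : [set w | pattern b n w = f] =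
    \bigcap_(k in [set` iota 0 n]) (X k @^-1` S k).
  apply/seteqP; split => w /=.
    move=> wf k /=; rewrite mem_iota add0n /= => kn.
    by rewrite /S insubT/= -wf ffunE/=; case: ifP => /= [|/negbT/negP].
  move=> H; apply/ffunP => i; rewrite ffunE.
  have /= := H i; rewrite mem_iota add0n ltn_ord => /(_ isT).
  rewrite /S valK/=.
  by case: (f i) => //= /negP/negbTE.
rewrite indX ?iota_uniq//.
rewrite -[in iota 0 n](subn0 n) -/(index_iota 0 n) big_mkord -prodEFin.
apply: eq_bigr => i _.
have -> : Pr (X i @^-1` S i) = P (S i) by rewrite -(lawX i _ (mS i)).
rewrite /S valK/=.
case: ifP => _; first by rewrite fineK// fin_num_measure.
by rewrite probability_setC// EFinB fineK// fin_num_measure.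
Qed.

Lemma measurable_pattern_event (b : pred T) n (Q : pred {ffun 'I_n -> bool}) :
  measurable [set x | b x] -> measurable [set w | Q (pattern b n w)].
Proof.
move=> mb.
exact: (measurable_finite_preimage (fun f => measurable_pattern f mb) (fun f => Q f)).
Qed.

Lemma pattern_event_prob (b : pred T) n (Q : pred {ffun 'I_n -> bool}) :
  measurable [set x | b x] ->
  Pr [set w | Q (pattern b n w)] =
  (\sum_(f | Q f) \prod_i (if f i then fine (P [set x | b x])
            else 1 - fine (P [set x | b x])))%:E.
Proof.
move=> mb; rewrite -sumEFin.
under eq_bigr do rewrite -pattern_prob//.
rewrite -[LHS]/(Pr _) -[X in Pr X]setTI measure_finite_preimage//.
  by apply: eq_bigr => f _; rewrite setTI.
by move=> f; exact: measurable_pattern.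
Qed.

Lemma measurable_deviation (b : pred T) n (t u : R) : measurable [set x | b x] ->
  measurable [set w | t < `|n%:R^-1 * (\sum_(i < n) (b (X i w))%:R) - u|].
Proof.
move=> mb.
have E w : \sum_(i < n) (pattern b n w i)%:R = \sum_(i < n) (b (X i w))%:R :> R.
  by apply: eq_bigr => i _; rewrite ffunE.
rewrite (_ : mkset _ = [set w | t <
    `|n%:R^-1 * (\sum_(i < n) (pattern b n w i)%:R) - u|]).
  exact: (measurable_pattern_event
    (fun f => t < `|n%:R^-1 * (\sum_(i < n) (f i)%:R) - u|) mb).
by apply/seteqP; split => w /=; rewrite E.
Qed.

Lemma empirical_deviation (b : pred T) n (t : R) : (0 < n)%N -> 0 < t ->
  measurable [set x | b x] ->
  (Pr [set w | (t < `|n%:R^-1 * (\sum_(i < n) (b (X i w))%:R) -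
                    fine (P [set x | b x])|)%R] <=
    (2 * expR (- (n%:R * t ^+ 2 / 8)))%:E)%E.
Proof.
move=> n0 t0 mb; set p := fine _.
have n0R : 0 < n%:R :> R by rewrite ltr0n.
have Pfin : P [set x | b x] \is a fin_num by exact: fin_num_measure.
have p01 : 0 <= p <= 1.
  by rewrite -!lee_fin fineK// measure_ge0 probability_le1.
pose S (f : {ffun 'I_n -> bool}) : R := \sum_i ((f i)%:R - p).
have SE w : n%:R^-1 * (\sum_(i < n) (b (X i w))%:R) - p =
    n%:R^-1 * S (pattern b n w).
  rewrite /S sumrB sumr_const card_ord -[p *+ n]mulr_natl mulrBr mulKf ?gt_eqF//.
  by congr (_ * _ - _); apply: eq_bigr => i _; rewrite ffunE.
(* For [t > 1] the event is empty, a frequency and a probability both lying in [[0, 1]]. For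
   [t <= 1] the choice of [l] below satisfies [|l| <= 1/2]. *)
have [t1|t1] := lerP t 1; last first.
  rewrite (_ : mkset _ = set0) ?measure0 ?lee_fin ?mulr_ge0 ?expR_ge0//.
  apply/seteqP; split => // w /=; apply/negP; rewrite -leNgt.
  apply: le_trans (ltW t1).
  have s0 : 0 <= n%:R^-1 * \sum_(i < n) (b (X i w))%:R :> R.
    by apply: mulr_ge0; [rewrite invr_ge0 ler0n|exact: sumr_ge0].
  have s1 : n%:R^-1 * \sum_(i < n) (b (X i w))%:R <= 1 :> R.
    rewrite ler_pdivrMl// mulr1 -[X in _ <= X%:R]card_ord -sumr_const.
    by apply: ler_sum => i _; case: (b _).
  move: s0 s1 p01; set s := _ * _ => s0 s1 /andP[p0 p1].
  by rewrite ler_norml; apply/andP; split; lra.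
(* The minimiser of [2 * l ^+ 2 - l * t], with minimum [- t ^+ 2 / 8]. *)
pose l := t / 4.
have l2 : `|l| <= 2^-1 by rewrite ger0_norm /l; lra.
have Nl2 : `|- l| <= 2^-1 by rewrite normrN.
pose Q1 f := n%:R * (l * t) < l * S f.
pose Q2 f := n%:R * (l * t) < - l * S f.
have l0 : 0 < l by rewrite /l; lra.
rewrite (_ : mkset _ = [set w | Q1 (pattern b n w)] `|` [set w | Q2 (pattern b n w)]);
    last first.
  apply/seteqP; split => w /=; rewrite SE /Q1 /Q2 mulNr -mulrN mulrCA !ltr_pM2l//.
    by rewrite lter_normr -mulrN !ltr_pdivlMl// => /orP.
  by move=> H; rewrite lter_normr -mulrN !ltr_pdivlMl//; apply/orP.
apply: (@le_trans _ _ (Pr [set w | Q1 (pattern b n w)] +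
    Pr [set w | Q2 (pattern b n w)])%E).
  by apply: measureU2; exact: measurable_pattern_event.
rewrite mulr_natl mulr2n EFinD (pattern_event_prob Q1 mb).
rewrite (pattern_event_prob Q2 mb) -/p.
have -> : - (n%:R * t ^+ 2 / 8) = n%:R * (2 * l ^+ 2 - l * t) by rewrite /l; field.
rewrite expRM_natl; apply: leeD; rewrite lee_fin; first exact: bernoulli_tail.
by rewrite -(sqrrN l); exact: bernoulli_tail.
Qed.

End chernoff.
(** * Lebesgue measure on boxes *)

Section boxes.
Context (R : realType) (d : nat).
Local Notation T := (d.-tuple R).
Local Notation lambda := (lebesgue_tuple R d).

Definition box (B : 'I_d -> set R) : set T :=
  [set x | forall i, B i (tnth x i)].

Lemma measurable_box (B : 'I_d -> set R) :
  (forall i, measurable (B i)) -> measurable (box B).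
Proof.
move=> mB; rewrite (_ : box B = \bigcap_(i in [set: 'I_d])
    (fun x : T => tnth x i) @^-1` B i).
  apply: fin_bigcap_measurable; first exact: finite_finset.
  move=> i _; rewrite -[X in measurable X]setTI; exact: measurable_tnth.
by apply/seteqP; split => x /= Bx i => [_|]; exact: Bx.
Qed.

Lemma cubeE : @cube R d = box (fun=> `[0, 1]%classic).
Proof.
by apply/seteqP; split => x /= H i; have := H i; rewrite ?in_itv//= in_itv.
Qed.

Lemma measurable_cube : measurable (@cube R d).
Proof. by rewrite cubeE; exact: measurable_box. Qed.

Lemma lebesgue_cube : lambda cube = 1%E.
Proof.
rewrite cubeE [LHS]lebesgue_tuple_box// big1// => i _.
by rewrite lebesgue_measure_itv/= lte_fin ltr01 oppr0 adde0.
Qed.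

(** Boxes form a pi-system that generates the product sigma-algebra and contains the whole space, so
    two measures that agree on them and are finite coincide. *)
Lemma measure_unique_box (m1 m2 : {measure set T -> \bar R}) :
  (m1 setT < +oo)%E ->
  (forall B : 'I_d -> set R, (forall i, measurable (B i)) ->
    m1 (box B) = m2 (box B)) ->
  forall A, measurable A -> m1 A = m2 A.
Proof.
move=> m1oo m12.
pose G := [set box B | B in [set B : 'I_d -> set R | forall i, measurable (B i)]].
have boxT : box (fun=> setT) = setT by apply/seteqP; split.
apply: (@measure_unique _ _ _ G (fun=> setT)) => //.
- apply/seteqP; split => A.
    apply: smallest_sub; first exact: smallest_sigma_algebra.
    rewrite -bigcup_seq => S [i _ [Y mY <-]]; rewrite setTI.
    apply: sub_sigma_algebra; exists (fun k => if k == i then Y else setT).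
      by move=> k /=; case: ifP.
    apply/seteqP; split => x /=; first by move/(_ i); rewrite eqxx.
    by move=> Yx k; case: eqP => // ->.
  apply: smallest_sub; first exact: sigma_algebra_measurable.
  by move=> S [B mB <-]; exact: measurable_box.
- move=> _ _ [B mB <-] [B' mB' <-]; exists (fun k => B k `&` B' k).
    by move=> k; exact: measurableI.
  apply/seteqP; split => x /=; first by move=> BB'; split => k; case: (BB' k).
  by move=> [H H'] k.
- by move=> _; exists (fun=> setT).
- by rewrite bigcup_const//; exists 0%N.
- by move=> _ [B mB <-]; exact: m12.
Qed.

Lemma dist2_le (x y : T) (t : R) : 0 <= t ->
  (forall i, `|tnth x i - tnth y i| <= t) -> dist2 x y <= d%:R * t.
Proof.
move=> t0 xy.
have dt0 : 0 <= d%:R * t by rewrite mulr_ge0.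
rewrite /dist2 -(ger0_norm dt0) -sqrtr_sqr ler_wsqrtr//.
apply: (@le_trans _ _ (\sum_(i < d) t ^+ 2)).
  apply: ler_sum => i _; rewrite -real_normK ?num_real//.
  by rewrite lerXn2r ?nnegrE.
rewrite sumr_const card_ord -[leLHS]mulr_natl exprMn ler_wpM2r ?sqr_ge0//.
by rewrite -natrX ler_nat; case: (d) => // k; rewrite expnS leq_pmulr.
Qed.

End boxes.

(** Both integrals are suprema over the simple functions below the integrand, so monotonicity holds
    for arbitrary functions. It thus applies to [p] without a proof that [p] is measurable. *)
Lemma le_integral_nonneg (R : realType) (dT : measure_display)
    (T : measurableType dT) (mu : {measure set T -> \bar R}) (D : set T)
    (f g : T -> \bar R) :
  (forall x, D x -> (0 <= f x)%E) -> (forall x, D x -> (f x <= g x)%E) ->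
  (\int[mu]_(x in D) f x <= \int[mu]_(x in D) g x)%E.
Proof.
move=> f0 fg; rewrite !ge0_integralE//; last first.
  by move=> x Dx; apply: le_trans (fg _ Dx); exact: f0.
apply: le_ereal_sup => _ [h hf <-]; exists h => // x.
apply: le_trans (hf x) _; rewrite /patch; case: ifPn => // xD.
by apply: fg; rewrite inE in xD.
Qed.

(** * Comparison of the law with Lebesgue measure *)

Section density.
Context (R : realType) (d : nat) (p : d.-tuple R -> R)
  (P : probability (d.-tuple R) R).
Hypothesis pP : has_density P p.
Local Notation lambda := (lebesgue_tuple R d).

Lemma density_le (A : set (d.-tuple R)) (a : R) : measurable A ->
  (forall x, A x -> cube x -> 0 <= p x <= a) ->
  (P A <= a%:E * lambda (A `&` cube))%E.
Proof.
move=> mA pa; rewrite pP// -integral_cst; last first.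
  by apply: measurableI => //; exact: measurable_cube.
by apply: le_integral_nonneg => x [Ax cx]; rewrite lee_fin;
  have /andP[] := pa x Ax cx.
Qed.

Lemma density_ge (A : set (d.-tuple R)) (a : R) : measurable A -> 0 <= a ->
  (forall x, A x -> cube x -> a <= p x) ->
  (a%:E * lambda (A `&` cube) <= P A)%E.
Proof.
move=> mA a0 pa; rewrite pP// -integral_cst; last first.
  by apply: measurableI => //; exact: measurable_cube.
by apply: le_integral_nonneg => x // [Ax cx]; rewrite lee_fin; exact: pa.
Qed.

End density.
(** * Conditional probabilities given a measurable map *)

Section image_law.
Context (R : realType) (dT dU : measure_display) (T : measurableType dT)
  (U : measurableType dU) (P : {measure set T -> \bar R}).

(** The image under [phi] of the restriction of [P] to [E]. The measurability proofs are arguments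
    so that the measure structure can be attached to the term itself. *)
Definition image_law (phi : T -> U) (E : set T)
    of measurable_fun setT phi & measurable E : set U -> \bar R :=
  fun S => P (E `&` phi @^-1` S).

Context (phi : T -> U) (E : set T)
  (mphi : measurable_fun setT phi) (mE : measurable E).
Local Notation nu := (image_law mphi mE).

Let mpre S : measurable S -> measurable (phi @^-1` S).
Proof. by move=> mS; rewrite -[X in measurable X]setTI; exact: mphi. Qed.

Let nu0 : nu set0 = 0%E.
Proof. by rewrite /image_law preimage_set0 setI0 measure0. Qed.

Let nu_ge0 S : (0 <= nu S)%E.
Proof. exact: measure_ge0. Qed.

Let nu_sigma_additive : semi_sigma_additive nu.
Proof.
move=> F mF tF mUF; rewrite /image_law preimage_bigcup setI_bigcupr.
apply: measure_semi_sigma_additive.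
- by move=> n; apply: measurableI => //; exact: mpre.
- apply/trivIsetP => /= i j _ _ ij; rewrite setIACA setIid -preimage_setI.
  by move/trivIsetP : tF => /(_ _ _ _ _ ij) ->//; rewrite preimage_set0 setI0.
- rewrite -setI_bigcupr -preimage_bigcup.
  by apply: measurableI => //; exact: mpre.
Qed.

HB.instance Definition _ := isMeasure.Build _ _ _ nu nu0 nu_ge0 nu_sigma_additive.

End image_law.

Section finite_image_law.
Context (R : realType) (dT dU : measure_display) (T : measurableType dT)
  (U : measurableType dU) (P : probability T R) (phi : T -> U) (E : set T)
  (mphi : measurable_fun setT phi) (mE : measurable E).
Local Notation nu := (image_law P mphi mE).

Let nu_fin : fin_num_fun nu.
Proof.
move=> S mS; apply: fin_num_measure; apply: measurableI => //.
by rewrite -[X in measurable X]setTI; exact: mphi.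
Qed.

HB.instance Definition _ := Measure_isFinite.Build _ _ _ nu nu_fin.

End finite_image_law.

Section conditional_version.
Context (R : realType) (dT dU : measure_display) (T : measurableType dT)
  (U : measurableType dU) (P : probability T R) (phi : T -> U).
Hypothesis mphi : measurable_fun setT phi.

(** [g] is the Radon-Nikodym derivative of the image of [P] restricted to [E] with respect to the
    image of [P]. It lives on [U], so [g \o phi] is a function of [phi] by construction. *)
Lemma exists_conditional_version (E : set T) : measurable E ->
  exists g : U -> R, [/\ measurable_fun setT g, forall y, 0 <= g y,
    P.-integrable setT (EFin \o (g \o phi)) &
    forall S, measurable S ->
      (\int[P]_(x in phi @^-1` S) (g (phi x))%:E = P (E `&` phi @^-1` S))%E].
Proof.
move=> mE.
pose mu := image_law P mphi measurableT.
pose nu := image_law P mphi mE.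
have muE : mu = pushforward P phi by apply/funext => S; rewrite /mu /image_law setTI.
have numu : nu `<< mu.
  move=> S muS B mB BS; apply/eqP; rewrite -measure_le0 -(muS B mB BS).
  by apply: le_measure; rewrite ?inE; [apply: measurableI|apply: measurableI|
    rewrite setTI]; rewrite // -[X in measurable X]setTI; exact: mphi.
have [f [f0 ffin intf fE]] := radon_nikodym_sigma_finite numu.
have mf := measurable_int _ intf.
have mg : measurable_fun setT (fine \o f) by exact: measurableT_comp.
have fgE y : (fine (f y))%:E = f y by rewrite fineK.
have mpre S : measurable S -> measurable (phi @^-1` S).
  by move=> mS; rewrite -[X in measurable X]setTI; exact: mphi.
have intE S : measurable S ->
    (\int[P]_(x in phi @^-1` S) f (phi x) = P (E `&` phi @^-1` S))%E.
  move=> mS; apply: etrans (esym (fE S mS)).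
  transitivity (\int[pushforward P phi]_(y in S) f y)%E; last by rewrite -muE.
  by rewrite ge0_integral_pushforward//; exact: measurable_funTS.
exists (fine \o f); split => //.
- by move=> y; exact: fine_ge0.
- apply/integrableP; split.
    by apply/measurable_EFinP; exact: measurableT_comp.
  rewrite (eq_integral (f \o phi)) => [|x _]; last by rewrite /comp fgE gee0_abs.
  by rewrite -(preimage_setT phi) intE// preimage_setT setIT ltey_eq fin_num_measure.
- by move=> S mS; rewrite -intE//; apply: eq_integral => x _; rewrite /= fgE.
Qed.

End conditional_version.

Lemma measure_eq0_of_lt_integral (R : realType) (dT : measure_display)
    (T : measurableType dT) (mu : {measure set T -> \bar R}) (A : set T)
    (f g : T -> R) : measurable A ->
  mu.-integrable A (EFin \o f) -> mu.-integrable A (EFin \o g) ->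
  (forall x, A x -> g x < f x) ->
  (\int[mu]_(x in A) (f x)%:E <= \int[mu]_(x in A) (g x)%:E)%E -> mu A = 0%E.
Proof.
move=> mA intf intg gf fgA.
have intfg : mu.-integrable A (EFin \o (f \- g)).
  by rewrite (_ : _ \o _ = (EFin \o f) \- (EFin \o g))%E//; exact: integrableB.
have mfg := measurable_int _ intfg.
have : (\int[mu]_(x in A) `|(f x - g x)%:E| = 0)%E.
  apply/eqP; rewrite eq_le integral_ge0// andbT.
  rewrite (eq_integral (fun x => (f x)%:E - (g x)%:E)%E); last first.
    move=> x; rewrite inE => Ax.
    by rewrite gee0_abs ?EFinB// lee_fin subr_ge0 ltW// gf.
  by rewrite integralB// leeBlDr ?add0e// integrable_fin_num.
move=> /(ae_eq_integral_abs _ mA mfg)[N [mN N0 AN]].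
apply: (subset_measure0 mA mN _ N0) => x Ax; apply: AN => /= /(_ Ax)[].
by apply/eqP; rewrite gt_eqF// subr_gt0 gf.
Qed.
(** * Cross-ratio identity for non-adjacent coordinates *)

(** The letters [a], [b], [c], [f] stand for conditional probabilities of the slabs 12, 21, 11, 22,
    and [c * f = a * b] is their product form. Multiplying [l1] and [l2] compares [a * b] with
    itself, with factors in the wrong order by [gap]; so [a * b = 0], and [l3] excludes that [b]
    alone vanishes. *)
Lemma cross_ratio_algebra (R : realType) (q11 q12 q21 q22 eps a b c f : R) :
  0 < eps -> 0 < q12 -> 0 < q21 -> eps < q11 -> eps < q22 -> eps < q21 ->
  eps * (q11 + q22 + q12 + q21) < q11 * q22 - q12 * q21 ->
  0 <= b -> 0 <= a -> c * f = a * b ->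
  (q11 - eps) * a <= (q12 + eps) * c -> (q22 - eps) * b <= (q21 + eps) * f ->
  (q21 - eps) * a <= (q12 + eps) * b -> a = 0.
Proof.
move=> eps0 q12_0 q21_0 e11 e22 e21 gap b0 a0 cf l1 l2 l3.
have u1 : 0 < q11 - eps by rewrite subr_gt0.
have u2 : 0 < q22 - eps by rewrite subr_gt0.
have u3 : 0 < q21 - eps by rewrite subr_gt0.
have v1 : 0 < q12 + eps by rewrite addr_gt0.
have ab0 : a * b = 0.
  have : ((q11 - eps) * a) * ((q22 - eps) * b) <=
         ((q12 + eps) * c) * ((q21 + eps) * f).
    by apply: ler_pM => //; rewrite mulr_ge0// ltW.
  rewrite mulrACA [leRHS]mulrACA cf -subr_ge0 -mulrBl.
  have -> : (q12 + eps) * (q21 + eps) - (q11 - eps) * (q22 - eps) =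
    eps * (q11 + q22 + q12 + q21) - (q11 * q22 - q12 * q21) by ring.
  move=> H; apply/eqP; rewrite eq_le mulr_ge0// andbT.
  have neg : eps * (q11 + q22 + q12 + q21) - (q11 * q22 - q12 * q21) < 0.
    by rewrite subr_lt0.
  by rewrite -(nmulr_rge0 _ neg).
apply/eqP; rewrite eq_le a0 andbT leNgt; apply/negP => a_gt0.
have bE : b = 0 by apply/eqP; move/eqP: ab0; rewrite mulf_eq0 gt_eqF.
by move: l3; rewrite bE mulr0 leNgt mulr_gt0.
Qed.

Section cross_ratio.
Context (R : realType) (d : nat) (i j : 'I_d).
Hypothesis ij : i != j.
Local Notation T := (d.-tuple R).
Local Notation lambda := (lebesgue_tuple R d).
Local Notation C := (~: [set i; j]).
Implicit Types (x y : T) (M S : set T) (I J : set R).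

Definition tupdate x (k : 'I_d) (a : R) : T :=
  [tuple if l == k then a else tnth x l | l < d].

(* [coord_sigma C] consists of the preimages of measurable sets under [clear], so
   that conditioning on the coordinates in [C] is conditioning on [clear]. *)
Definition clear x : T :=
  [tuple if (k == i) || (k == j) then 0 else tnth x k | k < d].

Lemma measurable_clear : measurable_fun setT clear.
Proof.
apply/measurable_fun_tnthP => k.
rewrite (_ : _ \o _ = if (k == i) || (k == j) then cst 0 else fun x => tnth x k).
  by case: ifP => _; [exact: measurable_cst|exact: measurable_tnth].
by apply/funext => x; rewrite /comp tnth_mktuple; case: ifP.
Qed.

Lemma measurable_preimage_clear M : measurable M -> measurable (clear @^-1` M).
Proof. by move=> mM; rewrite -[X in measurable X]setTI; exact: measurable_clear. Qed.

Lemma coord_sigma_measurable (A : {set 'I_d}) :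
  @coord_sigma R d A `<=` measurable.
Proof.
apply: smallest_sub; first exact: sigma_algebra_measurable.
move=> _ [k _ [Y mY <-]].
exact: (measurable_tnth k measurableT mY).
Qed.

Lemma coord_sigma_coord (A : {set 'I_d}) k (Y : set R) : k \in A ->
  measurable Y -> coord_sigma A [set x : T | Y (tnth x k)].
Proof.
move=> kA mY; apply: sub_sigma_algebra; exists k => //.
by exists Y => //; rewrite setTI.
Qed.

(** Good sets: the coordinates [i] and [j] of [clear] are constant, so their generators pull back to
    [set0] or [setT]; the other generators pull back to generators of [coord_sigma C]. *)
Lemma coord_sigma_preimage_clear M :
  measurable M -> coord_sigma C (clear @^-1` M).
Proof.
pose G := [set N : set T | coord_sigma C (clear @^-1` N)].
suff : measurable `<=` G by move=> + mM => /(_ M mM).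
apply: smallest_sub.
  have := sigma_algebra_image clear (smallest_sigma_algebra setT
    (\bigcup_(k in [set` C])
       preimage_set_system setT (fun x : T => tnth x k) measurable)).
  rewrite (_ : image_set_system _ _ _ = G)//.
  by apply/funext => N; rewrite /image_set_system/= setTI.
rewrite -bigcup_seq => _ [k _ [Y mY <-]]; rewrite setTI /G /=.
have [kij|kC] := boolP ((k == i) || (k == j)).
  rewrite (_ : _ @^-1` _ = if `[< Y 0 >] then setT else set0).
    by case: ifP => _; [rewrite -setC0; apply: sigma_algebraC|]; exact: sigma_algebra0.
  apply/seteqP; split => x; rewrite /preimage/= tnth_mktuple kij;
    by case: ifPn => /asboolP.
rewrite (_ : _ @^-1` _ = [set x | Y (tnth x k)]).
  by apply: coord_sigma_coord => //; rewrite !inE.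
by apply/seteqP; split => x; rewrite /preimage/= tnth_mktuple (negbTE kC).
Qed.

Lemma preimage_clear_coord_sigma S : coord_sigma C S -> clear @^-1` S = S.
Proof.
pose G := [set N : set T | clear @^-1` N = N].
suff : coord_sigma C `<=` G by move=> + CS => /(_ S CS).
apply: smallest_sub.
  split => [|N NG|F FG]; rewrite /G /=.
  - exact: preimage_set0.
  - by rewrite setTD -preimage_setC NG.
  - by rewrite preimage_bigcup; apply: eq_bigcup => // n _; exact: FG.
move=> _ [k kC [Y mY <-]]; rewrite setTI /G /=.
apply/seteqP; split => x; rewrite /preimage/= tnth_mktuple ifN//;
  by move: kC; rewrite /= !inE.
Qed.

Definition slab I J : set T := [set x | I (tnth x i) /\ J (tnth x j)].

Lemma measurable_slab I J : measurable I -> measurable J ->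
  measurable (slab I J).
Proof.
move=> mI mJ.
have mcoord k (Y : set R) : measurable Y -> measurable [set x : T | Y (tnth x k)].
  move=> mY; apply: (@coord_sigma_measurable [set k]%SET).
  by apply: coord_sigma_coord => //; rewrite finset.in_set1.
rewrite (_ : slab I J = [set x | I (tnth x i)] `&` [set x | J (tnth x j)])//.
by apply: measurableI; exact: mcoord.
Qed.

Let measurable_const (Q : Prop) : measurable [set _ : R | Q].
Proof.
have [q|q] := pselect Q.
  by rewrite (_ : mkset _ = setT)//; apply/seteqP; split.
by rewrite (_ : mkset _ = set0)//; apply/seteqP; split.
Qed.

(* The trace of Lebesgue measure on [slab I J], seen as a measure of the
   coordinates other than [i] and [j], only depends on the lengths of [I] and
   [J]. *)
Lemma lebesgue_slab I J I' J' M : measurable I -> measurable J ->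
  measurable I' -> measurable J' ->
  lebesgue_measure (`[0, 1]%classic `&` I) =
    lebesgue_measure (`[0, 1]%classic `&` I') ->
  lebesgue_measure (`[0, 1]%classic `&` J) =
    lebesgue_measure (`[0, 1]%classic `&` J') ->
  measurable M ->
  lambda (slab I J `&` clear @^-1` M `&` cube) =
  lambda (slab I' J' `&` clear @^-1` M `&` cube).
Proof.
move=> mI mJ mI' mJ' II' JJ' mM.
have mE : measurable (slab I J `&` cube).
  by apply: measurableI; [exact: measurable_slab|exact: measurable_cube].
have mE' : measurable (slab I' J' `&` cube).
  by apply: measurableI; [exact: measurable_slab|exact: measurable_cube].
rewrite ![slab _ _ `&` _ `&` cube]setIAC.
have E := @measure_unique_box R d (image_law lambda measurable_clear mE)
  (image_law lambda measurable_clear mE').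
apply: E => //.
  apply: (@le_lt_trans _ _ (lambda cube)).
    rewrite /image_law; apply: le_measure; rewrite ?inE.
    - by apply: measurableI => //; exact: measurable_preimage_clear.
    - exact: measurable_cube.
    - by move=> x [[]].
  by rewrite lebesgue_cube ltey.
move=> B mB.
change (lambda (slab I J `&` cube `&` clear @^-1` box B) =
  lambda (slab I' J' `&` cube `&` clear @^-1` box B)).
(* At [i] and [j] the constraint of [box B] bears on the cleared value 0 and becomes a condition
   independent of the point. The whole set is therefore again a box. *)
pose fiber I J (k : 'I_d) : set R := `[0, 1]%classic `&`
  (if k == i then I `&` [set _ | B i 0]
   else if k == j then J `&` [set _ | B j 0] else B k).
have fiberE I0 J0 : slab I0 J0 `&` cube `&` clear @^-1` (box B) = box (fiber I0 J0).
  apply/seteqP; split => x.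
    move=> [[[Ii Jj] cx] Bx] k; split; first by rewrite /= in_itv/=; exact: cx.
    have := Bx k; rewrite /preimage/= tnth_mktuple.
    have [->|_] /= := eqVneq k i; first by split.
    by have [->|_] /= := eqVneq k j; first by split.
  move=> xf; have [_ ] := xf i; rewrite eqxx => -[Ii Bi].
  have [_ ] := xf j; rewrite eq_sym (negbTE ij) eqxx => -[Jj Bj].
  split; first by split => // k; have [] := xf k; rewrite /= in_itv.
  move=> k; rewrite tnth_mktuple.
  have [->|ki] := eqVneq k i; first by [].
  have [->|kj] := eqVneq k j; first by [].
  by have [_] := xf k; rewrite (negbTE ki) (negbTE kj).
have mfiber I0 J0 k : measurable I0 -> measurable J0 -> measurable (fiber I0 J0 k).
  move=> mI0 mJ0; apply: measurableI => //.
  by case: ifP => _; [exact: measurableI|case: ifP => _//; exact: measurableI].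
rewrite !fiberE [LHS]lebesgue_tuple_box ?[RHS]lebesgue_tuple_box; first last.
- by move=> k; exact: mfiber.
- by move=> k; exact: mfiber.
apply: eq_bigr => k _; rewrite /fiber.
have cut (I0 : set R) (Q : Prop) :
    I0 `&` [set _ | Q] = if `[< Q >] then I0 else set0.
  apply/seteqP; split => [y [Iy /asboolP ->]//|y].
  by case: ifPn => // /asboolP.
rewrite !cut; case: ifP => _; first by case: ifP => // _; rewrite setI0.
by case: ifP => // _; case: ifP => // _; rewrite setI0.
Qed.

Context (p : T -> R) (P : probability T R) (e : rel 'I_d) (L : R).
Hypothesis pP : has_density P p.
Hypothesis p_pos : positive_on_cube p.
Hypothesis p_lip : forall x y, cube x -> cube y ->
  `|p x - p y| <= L * dist2 x y.
Hypothesis L_ge0 : 0 <= L.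
Hypothesis e_irr : irreflexive e.
Hypothesis nadj : ~~ e i j.
Hypothesis markov : markov_property e P.

Lemma exists_cond_prob (E : set T) : measurable E ->
  exists g : T -> R, [/\ measurable_fun setT g, forall y, 0 <= g y,
    is_cond_prob P (coord_sigma C) E (g \o clear) &
    forall S, measurable S ->
      (\int[P]_(x in clear @^-1` S) (g (clear x))%:E = P (E `&` clear @^-1` S))%E].
Proof.
move=> mE.
have [g [mg g0 intg gE]] := exists_conditional_version P measurable_clear mE.
exists g; split => //; split => //.
  move=> _ [Y mY <-]; rewrite setTI comp_preimage.
  by apply: coord_sigma_preimage_clear; rewrite -[X in measurable X]setTI; exact: mg.
move=> S CS; rewrite -{1}(preimage_clear_coord_sigma CS) gE; last first.
  exact: coord_sigma_measurable CS.
by rewrite preimage_clear_coord_sigma.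
Qed.

Lemma markov_product (I J : set R) h h' hh' : measurable I -> measurable J ->
  is_cond_prob P (coord_sigma C) [set x | I (tnth x i)] h ->
  is_cond_prob P (coord_sigma C) [set x | J (tnth x j)] h' ->
  is_cond_prob P (coord_sigma C) (slab I J) hh' ->
  {ae P, forall x, hh' x = h x * h' x}.
Proof.
move=> mI mJ hI hJ hIJ.
apply: (markov (A := [set i]%SET) (B := [set j]%SET) (C := C) _ _ _ _ _ _ hI hJ hIJ).
- by rewrite disjoints1 finset.in_set1.
- by rewrite disjoints1 !inE eqxx.
- by rewrite disjoints1 !inE eqxx orbT.
- move=> x y s; rewrite !finset.in_set1 => /eqP -> /eqP -> {x y}.
  (* The first edge of a path from [i] to [j] leads neither to [i], by irreflexivity, nor to [j], by
     non-adjacency; it lands in [C]. *)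
  case: s => [_ /= /eqP|k s /= /andP[ik _] _]; first by rewrite (negbTE ij).
  apply/orP; right; apply/orP; left; rewrite !inE negb_or.
  by apply/andP; split; apply: contraTneq ik => ->; rewrite ?e_irr.
- by apply: coord_sigma_coord => //; rewrite finset.in_set1.
- by apply: coord_sigma_coord => //; rewrite finset.in_set1.
Qed.

(** The set of [y] in [S] where the inequality fails is itself an admissible [M]. Integrating over
    it shows that its preimage is null. *)
Lemma cond_prob_le (E E' S : set T) (g g' : T -> R) (c c' : R) :
  measurable S -> measurable_fun setT g -> measurable_fun setT g' ->
  is_cond_prob P (coord_sigma C) E (g \o clear) ->
  is_cond_prob P (coord_sigma C) E' (g' \o clear) ->
  (forall M, measurable M -> M `<=` S ->
    (c%:E * P (E `&` clear @^-1` M) <= c'%:E * P (E' `&` clear @^-1` M))%E) ->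
  {ae P, forall x, S (clear x) -> c * g (clear x) <= c' * g' (clear x)}.
Proof.
move=> mS mg mg' [_ intg gE] [_ intg' gE'] cc'.
pose M := S `&` [set y | c' * g' y < c * g y].
have mM : measurable M.
  apply: measurableI => //; rewrite -[X in measurable X]setTI.
  apply: (measurable_fun_ltr _ _ measurableT (Y := [set true])) => //;
    exact: measurable_funM.
exists (clear @^-1` M); split.
- exact: measurable_preimage_clear.
- have mA := measurable_preimage_clear mM.
  have CA := coord_sigma_preimage_clear mM.
  have intcg : P.-integrable (clear @^-1` M) (EFin \o (fun x => c * g (clear x))).
    have := integrableS measurableT mA (@subsetT _ _) intg.
    by move=> /(integrableZl mA c).
  have intcg' : P.-integrable (clear @^-1` M) (EFin \o (fun x => c' * g' (clear x))).
    have := integrableS measurableT mA (@subsetT _ _) intg'.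
    by move=> /(integrableZl mA c').
  apply: (measure_eq0_of_lt_integral mA intcg intcg') => [x [_ //]|].
  under eq_integral do rewrite EFinM.
  under [leRHS]eq_integral do rewrite EFinM.
  rewrite !integralZl//.
  + by rewrite gE// gE'//; apply: cc' => // y [].
  + exact: integrableS measurableT mA (@subsetT _ _) intg'.
  + exact: integrableS measurableT mA (@subsetT _ _) intg.
- move=> x /= /not_implyP[Sx]; move/negP; rewrite -ltNge => lt.
  by split.
Qed.

(** Otherwise take boxes of side [delta] on which [p] is within [eps] of its corner value. Slabs
    over the four pairs have the same Lebesgue trace, so their conditional probabilities are nearly
    proportional to the values [q]; they also have product form by the Markov property. By
    [cross_ratio_algebra] one of them vanishes near [x], although its box has positive mass.
    Coordinates below 1 leave room for the boxes inside the cube. *)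
Lemma cross_ratio_le x (s1 s2 t1 t2 : R) : (forall k, 0 <= tnth x k < 1) ->
  0 <= s1 < 1 -> 0 <= s2 < 1 -> 0 <= t1 < 1 -> 0 <= t2 < 1 ->
  p (tupdate (tupdate x i s1) j t1) * p (tupdate (tupdate x i s2) j t2) <=
  p (tupdate (tupdate x i s1) j t2) * p (tupdate (tupdate x i s2) j t1).
Proof.
move=> x01 s101 s201 t101 t201.
pose z (s t : R) := tupdate (tupdate x i s) j t.
pose q s t := p (z s t).
have z01 (s t : R) k : 0 <= s < 1 -> 0 <= t < 1 -> 0 <= tnth (z s t) k < 1.
  by move=> s01 t01; rewrite !tnth_mktuple; case: ifP => // _; case: ifP.
have zcube (s t : R) : 0 <= s < 1 -> 0 <= t < 1 -> cube (z s t).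
  by move=> s01 t01 k; have /andP[-> /ltW ->] := z01 s t k s01 t01.
have q0 (s t : R) : 0 <= s < 1 -> 0 <= t < 1 -> 0 < q s t.
  by move=> s01 t01; apply: p_pos; exact: zcube.
rewrite -/(q s1 t1) -/(q s2 t2) -/(q s1 t2) -/(q s2 t1) leNgt; apply/negP => lt.
have q11 := q0 _ _ s101 t101; have q22 := q0 _ _ s201 t201.
have q12 := q0 _ _ s101 t201; have q21 := q0 _ _ s201 t101.
pose Delta := q s1 t1 * q s2 t2 - q s1 t2 * q s2 t1.
pose sigma := q s1 t1 + q s2 t2 + q s1 t2 + q s2 t1.
have sigma0 : 0 < sigma by rewrite !addr_gt0.
have Delta0 : 0 < Delta by rewrite subr_gt0.
have [eps [eps0 epsD [eps11 eps22 eps21]]] : exists eps : R,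
    [/\ 0 < eps, eps * sigma < Delta &
        [/\ eps < q s1 t1, eps < q s2 t2 & eps < q s2 t1 /\ eps < q s1 t2]].
  pose m := Num.min (Delta / sigma) (Num.min (Num.min (q s1 t1) (q s2 t2))
    (Num.min (q s2 t1) (q s1 t2))).
  have m0 : 0 < m by rewrite !lt_min divr_gt0// q11 q22 q21.
  have m2 : m / 2 < m by rewrite ltr_pdivrMr// ltr_pMr// ltr1n.
  exists (m / 2); split; first by rewrite divr_gt0.
    by rewrite -ltr_pdivlMr// (lt_le_trans m2)// ge_min lexx.
  by split; [| |split]; rewrite (lt_le_trans m2)// !ge_min lexx ?orbT.
have [delta [delta0 xdelta [s1d s2d t1d t2d] Ldelta]] : exists delta : R,
    [/\ 0 < delta, forall k, tnth x k + delta <= 1,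
      [/\ s1 + delta <= 1, s2 + delta <= 1, t1 + delta <= 1 & t2 + delta <= 1] &
      L * (d%:R * delta) <= eps].
  pose mx := \big[Num.min/1]_k (1 - tnth x k).
  (* The [+ 1] avoids a division by 0 when [L * d] vanishes. *)
  pose m := Num.min (eps / (L * d%:R + 1)) (Num.min mx
    (Num.min (Num.min (1 - s1) (1 - s2)) (Num.min (1 - t1) (1 - t2)))).
  have Ld0 : 0 < L * d%:R + 1 by rewrite ltr_wpDl// mulr_ge0.
  have m0 : 0 < m.
    rewrite !lt_min divr_gt0//= !subr_gt0.
    have [[/andP[_ ->] /andP[_ ->]] [/andP[_ ->] /andP[_ ->]]] :=
      ((s101, s201), (t101, t201)).
    rewrite !andbT; apply: lt_bigmin => // k _.
    by rewrite subr_gt0; case/andP: (x01 k).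
  exists m; split => //.
  - move=> k; rewrite -lerBrDl; apply: (@le_trans _ _ mx).
      by rewrite !ge_min lexx orbT.
    exact: bigmin_le.
  - by split; rewrite -lerBrDl !ge_min lexx ?orbT.
  - apply: (@le_trans _ _ ((L * d%:R + 1) * m)).
      by rewrite mulrA (ler_wpM2r (ltW m0))// lerDl ler01.
    by rewrite mulrC -ler_pdivlMr// ge_min lexx.
pose I (s : R) : set R := `[s, s + delta]%classic.
have mI s : measurable (I s) by exact: measurable_itv.
have leb s : lebesgue_measure (I s) = delta%:E.
  by rewrite lebesgue_measure_itv/= lte_fin ltrDl delta0 -EFinB addrAC subrr add0r.
have I01 s : 0 <= s < 1 -> s + delta <= 1 -> `[0, 1]%classic `&` I s = I s.
  move=> /andP[s0 _] s1'; apply/setIidPr => y; rewrite /I /= !in_itv/= => /andP[sy ys].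
  by rewrite (le_trans s0 sy) (le_trans ys).
pose E s t := slab (I s) (I t).
have mE s t : measurable (E s t) by exact: measurable_slab.
(* Only the coordinates in [C] are constrained; all comparisons take place where [clear y] lies in
   [S]. *)
pose S := box (fun k => if (k == i) || (k == j) then setT else I (tnth x k)).
have mS : measurable S.
  by apply: measurable_box => k; case: ifP.
have ES s t : E s t `&` clear @^-1` S = box (fun k => I (tnth (z s t) k)).
  apply/seteqP; split => y.
    move=> [[yi yj] Sy] k; rewrite !tnth_mktuple; have := Sy k; rewrite tnth_mktuple.
    have [->|ki] := eqVneq k j; first by [].
    by have [->|kj] := eqVneq k i.
  move=> yz; split.
    split; first by have := yz i; rewrite !tnth_mktuple eqxx (negbTE ij).
    by have := yz j; rewrite !tnth_mktuple eqxx.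
  move=> k; have := yz k; rewrite !tnth_mktuple.
  have [->|ki] := eqVneq k i; first by [].
  by have [->|kj] := eqVneq k j.
have near_z s t y : 0 <= s < 1 -> 0 <= t < 1 -> (E s t `&` clear @^-1` S) y ->
    cube y -> `|p y - q s t| <= eps.
  move=> s01 t01; rewrite ES => yz cy.
  apply: le_trans (p_lip cy (zcube _ _ s01 t01)) _.
  apply: le_trans Ldelta; rewrite ler_wpM2l//.
  apply: dist2_le => [|k]; first exact: ltW.
  have := yz k; rewrite /I /= in_itv/= => /andP[zy yz'].
  by rewrite ger0_norm ?subr_ge0// lerBlDl.
have mEM s t M : measurable M -> measurable (E s t `&` clear @^-1` M).
  by move=> mM; apply: measurableI => //; exact: measurable_preimage_clear.
have P_le s t M : 0 <= s < 1 -> 0 <= t < 1 -> measurable M -> M `<=` S ->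
    (P (E s t `&` clear @^-1` M) <=
     (q s t + eps)%:E * lambda (E s t `&` clear @^-1` M `&` cube))%E.
  move=> s01 t01 mM MS; apply: density_le; [exact: pP|exact: mEM|].
  move=> y [Ey My] cy; rewrite ltW ?p_pos//=.
  have := near_z s t y s01 t01 (conj Ey (MS _ My)) cy.
  by rewrite ler_norml => /andP[_]; rewrite lerBlDl.
have P_ge s t M : 0 <= s < 1 -> 0 <= t < 1 -> eps < q s t ->
    measurable M -> M `<=` S ->
    ((q s t - eps)%:E * lambda (E s t `&` clear @^-1` M `&` cube) <=
     P (E s t `&` clear @^-1` M))%E.
  move=> s01 t01 epsq mM MS; apply: density_ge; [exact: pP|exact: mEM| |].
    by rewrite subr_ge0 ltW.
  move=> y [Ey My] cy.
  have := near_z s t y s01 t01 (conj Ey (MS _ My)) cy.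
  by rewrite ler_norml => /andP[+ _]; rewrite lerBrDl addrC.
have Lam s t s' t' M : 0 <= s < 1 -> 0 <= t < 1 -> 0 <= s' < 1 -> 0 <= t' < 1 ->
    s + delta <= 1 -> t + delta <= 1 -> s' + delta <= 1 -> t' + delta <= 1 ->
    measurable M ->
    lambda (E s t `&` clear @^-1` M `&` cube) =
    lambda (E s' t' `&` clear @^-1` M `&` cube).
  by move=> *; apply: lebesgue_slab; rewrite ?I01 ?leb.
have mcoord k s : measurable [set y : T | I s (tnth y k)].
  apply: (@coord_sigma_measurable [set k]%SET).
  by apply: coord_sigma_coord; rewrite ?finset.in_set1.
have [g gP] := choice (fun st : R * R => exists_cond_prob (mE st.1 st.2)).
have [h hP] := choice (fun s : R => exists_cond_prob (mcoord i s)).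
have [h' hP'] := choice (fun t : R => exists_cond_prob (mcoord j t)).
have prod s t :
    {ae P, forall y, g (s, t) (clear y) = h s (clear y) * h' t (clear y)}.
  have [_ _ gst _] := gP (s, t); have [_ _ hs _] := hP s; have [_ _ ht _] := hP' t.
  exact: (markov_product (mI s) (mI t) hs ht gst).
(* By [Lam] the two slabs have equal Lebesgue trace above any [M], so [P_le] and [P_ge] compare
   their probabilities through [q] alone. *)
have cmp s t s' t' : 0 <= s < 1 -> 0 <= t < 1 -> 0 <= s' < 1 -> 0 <= t' < 1 ->
    s + delta <= 1 -> t + delta <= 1 -> s' + delta <= 1 -> t' + delta <= 1 ->
    eps < q s' t' ->
    {ae P, forall y, S (clear y) ->
      (q s' t' - eps) * g (s, t) (clear y) <= (q s t + eps) * g (s', t') (clear y)}.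
  move=> s01 t01 s01' t01' sd td sd' td' epsq.
  have [mg _ gst _] := gP (s, t); have [mg' _ gst' _] := gP (s', t').
  apply: (cond_prob_le mS mg mg' gst gst') => M mM MS.
  apply: (@le_trans _ _ ((q s' t' - eps)%:E * ((q s t + eps)%:E *
      lambda (E s t `&` clear @^-1` M `&` cube)))%E).
    apply: lee_wpmul2l; first by rewrite lee_fin subr_ge0 ltW.
    exact: P_le.
  rewrite muleCA (Lam s t s' t')//; apply: lee_wpmul2l; last exact: P_ge.
  by rewrite lee_fin addr_ge0// ltW// q0.
have c1 := cmp _ _ _ _ s101 t201 s101 t101 s1d t2d s1d t1d eps11.
have c2 := cmp _ _ _ _ s201 t101 s201 t201 s2d t1d s2d t2d eps22.
have c3 := cmp _ _ _ _ s101 t201 s201 t101 s1d t2d s2d t1d eps21.1.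
have g12_0 : {ae P, forall y, S (clear y) -> g (s1, t2) (clear y) = 0}.
  have p11 := prod s1 t1; have p12 := prod s1 t2.
  have p21 := prod s2 t1; have p22 := prod s2 t2.
  near=> y => Sy.
  have /(_ Sy) l3 : S (clear y) -> (q s2 t1 - eps) * g (s1, t2) (clear y) <=
      (q s1 t2 + eps) * g (s2, t1) (clear y) by near: y.
  have /(_ Sy) l2 : S (clear y) -> (q s2 t2 - eps) * g (s2, t1) (clear y) <=
      (q s2 t1 + eps) * g (s2, t2) (clear y) by near: y.
  have /(_ Sy) l1 : S (clear y) -> (q s1 t1 - eps) * g (s1, t2) (clear y) <=
      (q s1 t2 + eps) * g (s1, t1) (clear y) by near: y.
  have e11 : g (s1, t1) (clear y) = h s1 (clear y) * h' t1 (clear y) by near: y.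
  have e12 : g (s1, t2) (clear y) = h s1 (clear y) * h' t2 (clear y) by near: y.
  have e21 : g (s2, t1) (clear y) = h s2 (clear y) * h' t1 (clear y) by near: y.
  have e22 : g (s2, t2) (clear y) = h s2 (clear y) * h' t2 (clear y) by near: y.
  move: l3; move: l2; move: l1.
  have : g (s1, t1) (clear y) * g (s2, t2) (clear y) =
         g (s1, t2) (clear y) * g (s2, t1) (clear y).
    by rewrite e11 e22 e12 e21 mulrACA [in RHS]mulrACA (mulrC (h' t1 _)).
  have [_ g0 _ _] := gP (s1, t2); move: (g0 (clear y)) => {g0}.
  have [_ g0 _ _] := gP (s2, t1); move: (g0 (clear y)) => {g0}.
  by move=> b0 a0; apply: cross_ratio_algebra epsD _ _; rewrite ?eps21.1//.
have intS : (\int[P]_(y in clear @^-1` S) (g (s1, t2) (clear y))%:E = 0)%E.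
  have [mg _ _ _] := gP (s1, t2).
  rewrite (ae_eq_integral (cst 0%E)) ?integral0//.
  - exact: measurable_preimage_clear.
  - apply/measurable_EFinP; apply: measurable_funTS.
    exact: measurableT_comp mg measurable_clear.
  - apply: filterS g12_0 => y gy Sy; exact/(congr1 EFin (gy Sy)).
have [_ _ _ gS] := gP (s1, t2).
(* The vanishing integral is the probability of the box at [z s1 t2], which is at least
   [q s1 t2 - eps] times its volume, a positive number. *)
have := P_ge s1 t2 S s101 t201 eps21.2 mS (@subset_refl _ _).
rewrite -gS// intS leNgt => /negP; apply.
rewrite mule_gt0 ?lte_fin ?subr_gt0//; first exact: eps21.2.
rewrite ES (_ : _ `&` _ = box (fun k => I (tnth (z s1 t2) k))).
  rewrite [X in (_ < X)%E]lebesgue_tuple_box// (eq_bigr (fun=> delta%:E)) => [|k _].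
    by rewrite prodEFin lte_fin prodr_gt0.
  exact: leb.
apply/setIidPl => y yz k; have := yz k; rewrite /I /= in_itv/= => /andP[zy yz'].
have /andP[z0 _] := z01 s1 t2 k s101 t201.
rewrite (le_trans z0 zy) (le_trans yz')// !tnth_mktuple.
by case: ifP => // _; case: ifP.
Unshelve. all: by end_near.
Qed.

End cross_ratio.
(** * Discretization of the cube *)

Section cells.
Context (R : realType) (d m : nat).
Local Notation M := m.+1.
Local Notation T := (d.-tuple R).
Local Notation cellT := {ffun 'I_d -> 'I_M}.
Local Notation lambda := (lebesgue_tuple R d).
Implicit Types (y : R) (x : T) (c : cellT) (k : 'I_M).

Let M0 : 0 < M%:R :> R. Proof. by rewrite ltr0n. Qed.

(** The last bin is unbounded above, so that the endpoint 1 belongs to a bin. *)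
Definition in_bin y k : bool :=
  (k%:R / M%:R <= y) && ((y < k.+1%:R / M%:R) || (k == ord_max)).

(* Negative reals are put in the bin of index 0. *)
Definition bin y : 'I_M := odflt ord0 [pick k | in_bin y k].

Let in_bin_inj y k l : in_bin y k -> in_bin y l -> k = l.
Proof.
have lt (k1 k2 : 'I_M) : in_bin y k1 -> in_bin y k2 -> ~~ (k1 < k2)%N.
  move=> /andP[_ k1y] /andP[k2y _]; apply/negP => k12.
  case/orP: k1y => [k1y|/eqP k1m].
    have := le_lt_trans k2y k1y; rewrite ltr_pM2r ?invr_gt0// ltr_nat ltnS.
    by rewrite leqNgt k12.
  by move: k12; rewrite k1m/= ltnNge -ltnS ltn_ord.
move=> yk yl; apply: ord_inj; apply/eqP; rewrite eqn_leq.
by apply/andP; split; rewrite leqNgt; exact: lt.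
Qed.

Lemma binP y : 0 <= y -> in_bin y (bin y).
Proof.
move=> y0; rewrite /bin; case: pickP => //= none.
have z0 : 0 <= y * M%:R by rewrite mulr_ge0// ltW.
have /andP[k1 k2] := truncn_itv z0.
have [ltM|geM] := ltnP (Num.truncn (y * M%:R)) M.
  have := none (Ordinal ltM).
  by rewrite /in_bin/= ler_pdivrMr// ltr_pdivlMr// k1 k2.
have := none ord_max; rewrite /in_bin eqxx orbT andbT/= ler_pdivrMr//.
by rewrite (le_trans _ k1)// ler_nat ltnW.
Qed.

Lemma binE y k : 0 <= y -> (bin y == k) = in_bin y k.
Proof.
move=> y0; apply/eqP/idP => [<-|yk]; first exact: binP.
exact: in_bin_inj (binP y0) yk.
Qed.

Let bin_lt0 y : y < 0 -> bin y = ord0.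
Proof.
move=> y0; rewrite /bin; case: pickP => //= k /andP[ky _].
by have := lt_le_trans y0 (le_trans (divr_ge0 (ler0n _ _) (ltW M0)) ky); rewrite ltxx.
Qed.

Lemma measurable_bin k : measurable [set y | bin y = k].
Proof.
rewrite (_ : mkset _ =
  (`]-oo, 0[%classic `&` [set _ | ord0 = k]) `|`
  (`[0, +oo[%classic `&` (`[k%:R / M%:R, +oo[%classic `&`
  (`]-oo, k.+1%:R / M%:R[%classic `|` [set _ | k = ord_max])))).
  have mc (Q : Prop) : measurable [set _ : R | Q].
    have [q|q] := pselect Q.
      by rewrite (_ : mkset _ = setT)//; apply/seteqP; split.
    by rewrite (_ : mkset _ = set0)//; apply/seteqP; split.
  apply: measurableU; first by apply: measurableI.
  apply: measurableI => //; apply: measurableI => //.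
  by apply: measurableU.
apply/seteqP; split => y /=; rewrite !in_itv/= ?andbT.
  have [y0 /eqP|y0] := leP 0 y; last by rewrite bin_lt0//; left.
  by rewrite binE// => /andP[-> /orP[->|/eqP ->]]; right; split => //;
    split => //; [left|right].
move=> [[y0 <-]|[y0 [ky H]]]; first exact: bin_lt0.
apply/eqP; rewrite binE// /in_bin ky/=.
by case: H => [->//|->]; rewrite eqxx orbT.
Qed.

Lemma lebesgue_bin k :
  lebesgue_measure ([set y | bin y = k] `&` `[0, 1]%classic) = (M%:R^-1)%:E.
Proof.
have [->|km] := eqVneq k ord_max.
  rewrite (_ : _ `&` _ = `[m%:R / M%:R, 1]%classic).
    rewrite lebesgue_measure_itv/= lte_fin ltr_pdivrMr// mul1r ltr_nat leqnn.
    rewrite -EFinD; congr (_%:E); rewrite -natr1; field.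
    by rewrite natr1 gt_eqF.
  apply/seteqP; split => y /=; rewrite !in_itv/=.
    by move=> [/eqP + /andP[y0 ->]]; rewrite binE// => /andP[-> _].
  move=> /andP[my y1]; have y0 : 0 <= y by apply: le_trans my; rewrite divr_ge0// ltW.
  by split; [apply/eqP; rewrite binE// /in_bin my eqxx orbT|rewrite y0].
rewrite (_ : _ `&` _ = `[k%:R / M%:R, k.+1%:R / M%:R[%classic).
  rewrite lebesgue_measure_itv/= lte_fin ltr_pM2r ?invr_gt0// ltr_nat leqnn.
  rewrite -EFinD; congr (_%:E); rewrite -natr1; field.
  by rewrite gt_eqF.
apply/seteqP; split => y /=; rewrite !in_itv/=.
  by move=> [/eqP + /andP[y0 y1]]; rewrite binE// /in_bin (negbTE km) orbF.
move=> /andP[ky yk]; have y0 : 0 <= y by apply: le_trans ky; rewrite divr_ge0// ltW.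
split; first by apply/eqP; rewrite binE// /in_bin ky yk.
rewrite y0/= (le_trans (ltW yk))// ler_pdivrMr// mul1r ler_nat.
by rewrite ltn_ord.
Qed.

Definition cell x : cellT := [ffun i => bin (tnth x i)].

Definition corner c : T := [tuple (c i)%:R / M%:R | i < d].

Lemma measurable_cell c : measurable [set x | cell x = c].
Proof.
rewrite (_ : mkset _ = box (fun i => [set y | bin y = c i])).
  by apply: measurable_box => i; exact: measurable_bin.
apply/seteqP; split => x /=; first by move=> <- i; rewrite ffunE.
by move=> H; apply/ffunP => i; rewrite ffunE; exact: H.
Qed.

Lemma lebesgue_cell c :
  lambda (cube `&` [set x | cell x = c]) = (M%:R ^- d)%:E.
Proof.
rewrite (_ : _ `&` _ = box (fun i => [set y | bin y = c i] `&` `[0, 1]%classic)).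
  rewrite [LHS]lebesgue_tuple_box => [|i]; last first.
    by apply: measurableI => //; exact: measurable_bin.
  under eq_bigr do rewrite lebesgue_bin.
  by rewrite prodEFin prodr_const card_ord exprVn.
apply/seteqP; split => x /=.
  by move=> [cx <-] i; rewrite /= ffunE in_itv/=; split => //; exact: cx.
move=> H; split => [i|]; first by have [_] := H i; rewrite /= in_itv.
by apply/ffunP => i; rewrite ffunE; have [] := H i.
Qed.

(** The corner is the lowest vertex of its cell, which gives the strict bound that [cross_ratio_le]
    asks for. *)
Lemma corner_itv c i : 0 <= tnth (corner c) i < 1.
Proof.
rewrite tnth_mktuple; apply/andP; split; first by rewrite divr_ge0// ltW.
by rewrite ltr_pdivrMr// mul1r ltr_nat ltn_ord.
Qed.

Lemma cube_corner c : cube (corner c).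
Proof. by move=> i; have /andP[-> /ltW ->] := corner_itv c i. Qed.

Lemma corner_update c i (a : 'I_M) :
  corner (update c i a) = tupdate (corner c) i (a%:R / M%:R).
Proof.
by apply: eq_from_tnth => l; rewrite !tnth_mktuple ffunE; case: ifP.
Qed.

Lemma dist2_corner x : cube x -> dist2 x (corner (cell x)) <= d%:R / M%:R.
Proof.
move=> cx; apply: dist2_le => [|i]; first by rewrite invr_ge0 ltW.
rewrite tnth_mktuple ffunE; have /andP[x0 x1] := cx i.
have /andP[bx xb] := binP x0; rewrite ger0_norm ?subr_ge0// lerBlDl.
rewrite -[in X in _ + X]div1r -mulrDl natr1; case/orP: xb => [/ltW//|/eqP ->].
by rewrite divff// gt_eqF.
Qed.

End cells.

(** * Additivity of the log-density on the grid *)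

Section log_cross_ratio.
Context (R : realType) (d : nat) (p : d.-tuple R -> R)
  (P : probability (d.-tuple R) R) (e : rel 'I_d) (L : R).
Hypothesis pP : has_density P p.
Hypothesis p_pos : positive_on_cube p.
Hypothesis p_lip : forall x y, cube x -> cube y ->
  `|p x - p y| <= L * dist2 x y.
Hypothesis L_ge0 : 0 <= L.
Hypothesis e_irr : irreflexive e.
Hypothesis markov : markov_property e P.

(** [cross_ratio_le] is one-sided; exchanging the two values of coordinate [j] gives the reverse
    inequality. *)
Lemma log_cross_ratio m (i j : 'I_d) (c : {ffun 'I_d -> 'I_m.+1}) a b :
  i != j -> ~~ e i j ->
  let u c := ln (p (corner R c)) in
  u c + u (update (update c i a) j b) = u (update c i a) + u (update c j b).
Proof.
move=> ij eij u; rewrite /u.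
pose v (k : 'I_m.+1) : R := k%:R / m.+1%:R.
have v01 (k : 'I_m.+1) : 0 <= v k < 1.
  by have := corner_itv R [ffun=> k] i; rewrite tnth_mktuple ffunE.
have p0 c' : 0 < p (corner R c') by exact/p_pos/cube_corner.
have H := cross_ratio_le ij pP p_pos p_lip L_ge0 e_irr eij markov (corner_itv R c).
have Ei : update c i (c i) = c.
  by apply/ffunP => k; rewrite ffunE; case: eqP => [->|].
have Ej : update c j (c j) = c.
  by apply/ffunP => k; rewrite ffunE; case: eqP => [->|].
have Eij : update (update c i a) j (c j) = update c i a.
  apply/ffunP => k; rewrite !ffunE; case: (k =P j) => [->|//].
  by rewrite eq_sym (negbTE ij).
have H1 := H _ _ _ _ (v01 (c i)) (v01 a) (v01 (c j)) (v01 b).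
have H2 := H _ _ _ _ (v01 (c i)) (v01 a) (v01 b) (v01 (c j)).
rewrite -!corner_update Ei Ej Eij in H1 H2.
rewrite -!lnM ?posrE//; congr ln; apply/eqP; rewrite eq_le.
by apply/andP; split; [rewrite [leRHS]mulrC|rewrite [leLHS]mulrC].
Qed.

End log_cross_ratio.

(** * Bounds on the density and its logarithm *)

Section lower_bound.
Context (R : realType) (d : nat) (p : d.-tuple R -> R) (L : R).
Hypothesis p_pos : positive_on_cube p.
Hypothesis p_lip : forall x y, cube x -> cube y ->
  `|p x - p y| <= L * dist2 x y.
Hypothesis L_ge0 : 0 <= L.

Let row_tuple (v : 'rV[R]_d) : d.-tuple R := [tuple v ord0 i | i < d].

(** A continuous function on the compact cube attains its extrema, and the minimum is positive.
    [row_tuple] transports the problem to row vectors, on which the extreme value theorem is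
    stated. *)
Lemma density_bounds : exists2 B : R, 0 < B &
  forall x, cube x -> p x <= B /\ `|ln (p x)| <= B.
Proof.
pose A := [set v : 'rV[R]_d | forall i, `[0, 1]%classic (v ord0 i)].
have A0 : A !=set0.
  by exists 0 => i /=; rewrite mxE in_itv/= lexx ler01.
have cA : compact A.
  by apply: (@rV_compact R d (fun=> `[0, 1]%classic)) => i; exact: segment_compact.
have AC v : A v -> cube (row_tuple v).
  by move=> Av i; rewrite tnth_mktuple; have := Av i; rewrite /= in_itv.
have ctsA : {within A, continuous (p \o row_tuple)}.
  apply/subspace_continuousP => v Av; apply/cvgrPdist_le => eps eps0.
  have Ld0 : 0 < L * d%:R + 1 by rewrite ltr_wpDl// mulr_ge0.
  have t0 : 0 < eps / (L * d%:R + 1) by rewrite divr_gt0.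
  near=> w.
  have Aw : A w by near: w; rewrite near_withinE; exact: nearW.
  have vw : ball v (eps / (L * d%:R + 1)) w.
    by near: w; rewrite near_withinE; apply: filterS (nbhsx_ballx v _ t0) => u.
  rewrite /=; apply: le_trans (p_lip (AC _ Av) (AC _ Aw)) _.
  apply: (@le_trans _ _ (L * (d%:R * (eps / (L * d%:R + 1))))).
    rewrite ler_wpM2l//; apply: dist2_le => [|i]; first exact: ltW.
    by rewrite !tnth_mktuple ltW//; exact: (vw.2 ord0 i).
  by rewrite !mulrA ler_pdivrMr// mulrC (ler_wpM2l (ltW eps0))// lerDl ler01.
have [v vA vmin] := EVT_min_rV A0 cA ctsA.
have [w wA wmax] := EVT_max_rV A0 cA ctsA.
pose B := Num.max (p (row_tuple w))
  (Num.max `|ln (p (row_tuple w))| `|ln (p (row_tuple v))|).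
have w0 : 0 < p (row_tuple w) by apply/p_pos/AC; rewrite inE in wA.
exists B; first by rewrite lt_max w0.
move=> x cx.
pose vx : 'rV[R]_d := \row_i tnth x i.
have Avx : vx \in A by rewrite inE => i; rewrite /= mxE in_itv; exact: cx.
have xE : row_tuple vx = x by apply: eq_from_tnth => i; rewrite tnth_mktuple mxE.
have := vmin _ Avx; have := wmax _ Avx; rewrite /= xE => pw vp.
split; first by rewrite le_max pw.
have v0 : 0 < p (row_tuple v) by apply/p_pos/AC; rewrite inE in vA.
have lnv : ln (p (row_tuple v)) <= ln (p x) by rewrite ler_ln ?posrE// p_pos.
have lnw : ln (p x) <= ln (p (row_tuple w)) by rewrite ler_ln ?posrE// p_pos.
have b1 : - ln (p x) <= `|ln (p (row_tuple v))|.
  by rewrite -normrN (le_trans _ (ler_norm _))// lerN2.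
have b2 := le_trans lnw (ler_norm _).
by rewrite /B ler_norml lerNl !le_max b1 b2 !orbT.
Unshelve. all: by end_near.
Qed.

End lower_bound.

(** * The estimator *)

Section estimator.
Context (R : realType) (d : nat) (e : rel 'I_d) (r m n : nat).
Local Notation M := m.+1.
Local Notation T := (d.-tuple R).
Local Notation cellT := {ffun 'I_d -> 'I_M}.
Local Notation lambda := (lebesgue_tuple R d).
Local Notation param := (gibbs_param d r m).

Definition empirical (s : {ffun 'I_n -> cellT}) (c : cellT) : R :=
  n%:R^-1 * \sum_(i < n) (s i == c)%:R.

Definition gibbs_mass (th : param) (c : cellT) : R :=
  gibbs R e th c / M%:R ^+ d.

Definition select (s : {ffun 'I_n -> cellT}) : param :=
  min_distance gibbs_mass [ffun=> ord0] (empirical s).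

Definition sample_cells (z : n.-tuple T) : {ffun 'I_n -> cellT} :=
  [ffun i => cell m (tnth z i)].

Definition estimator (z : n.-tuple T) (x : T) : R :=
  gibbs R e (select (sample_cells z)) (cell m x).

Lemma measurable_sample_cells s : measurable [set z | sample_cells z = s].
Proof.
rewrite (_ : mkset _ = \bigcap_(i in [set: 'I_n])
    (fun z : n.-tuple T => tnth z i) @^-1` [set x | cell m x = s i]).
  apply: fin_bigcap_measurable => [|i _]; first exact: finite_finset.
  rewrite -[X in measurable X]setTI; apply: measurable_tnth => //.
  exact: measurable_cell.
apply/seteqP; split => z /=; first by move=> <- i _; rewrite /= ffunE.
by move=> H; apply/ffunP => i; rewrite ffunE; exact: H.
Qed.

(** The estimator sees the sample and the point only through their cells, which take finitely many
    values. *)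
Lemma measurable_estimator :
  measurable_fun [set: n.-tuple T * T] (fun z => estimator z.1 z.2).
Proof.
pose h (z : n.-tuple T * T) := (sample_cells z.1, cell m z.2).
apply: (@measurable_fun_finite _ _ _ h _ _ _ (fun f => gibbs R e (select f.1) f.2)).
move=> [s c]; rewrite (_ : mkset _ =
  [set z | sample_cells z = s] `*` [set x | cell m x = c]).
  by apply: measurableX; [exact: measurable_sample_cells|exact: measurable_cell].
by apply/seteqP; split => -[z x] /=; rewrite /h => -[-> ->].
Qed.

Lemma sum_empirical (s : {ffun 'I_n -> cellT}) (A : pred cellT) :
  \sum_(c | A c) empirical s c = n%:R^-1 * \sum_(i < n) (A (s i))%:R.
Proof.
rewrite /empirical -mulr_sumr exchange_big/=; congr (_ * _).
apply: eq_bigr => i _; case: (boolP (A (s i))) => Asi.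
  rewrite (bigD1 (s i))//= eqxx big1 ?addr0// => c /andP[_ csi].
  by rewrite eq_sym (negbTE csi).
rewrite big1// => c Ac; case: eqP => // E.
by rewrite E Ac in Asi.
Qed.

Context (p : T -> R) (P : probability T R) (L B : R).
Hypothesis pP : has_density P p.
Hypothesis p_pos : positive_on_cube p.
Hypothesis p_lip : forall x y, cube x -> cube y ->
  `|p x - p y| <= L * dist2 x y.
Hypothesis L_ge0 : 0 <= L.
Hypothesis p_bound : forall x, cube x -> p x <= B /\ `|ln (p x)| <= B.
Hypothesis clique_r : forall K, is_clique e K -> (#|K| <= r)%N.
Hypothesis e_irr : irreflexive e.
Hypothesis markov : markov_property e P.

Definition cell_prob (c : cellT) : R := fine (P [set x | cell m x = c]).

(** The data estimate [cell_prob], but the family approximates these masses, for which the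
    cross-ratio identity is exact. The two are within [osc] in [l1]. *)
Definition corner_mass (c : cellT) : R := p (corner R c) / M%:R ^+ d.

Let M0 : 0 < M%:R :> R. Proof. by rewrite ltr0n. Qed.

Let Md0 : 0 < M%:R ^+ d :> R. Proof. by rewrite exprn_gt0. Qed.

Let card_cell : (#|{: cellT}|%:R : R) = M%:R ^+ d.
Proof. by rewrite card_ffun !card_ord natrX. Qed.

Let sum_cell_le (f : cellT -> R) (t : R) : (forall c, f c <= t / M%:R ^+ d) ->
  \sum_c f c <= t.
Proof.
move=> ft; apply: (@le_trans _ _ (\sum_(c : cellT) t / M%:R ^+ d)).
  by apply: ler_sum => c _; exact: ft.
by rewrite sumr_const -[leLHS]mulr_natl card_cell mulrCA divff ?mulr1//.
Qed.

Let osc : R := L * (d%:R / M%:R).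

Let osc0 : 0 <= osc. Proof. by rewrite mulr_ge0// divr_ge0// ltW. Qed.

Let osc_cell x : cube x -> `|p x - p (corner R (cell m x))| <= osc.
Proof.
move=> cx; apply: le_trans (p_lip cx (cube_corner _ _)) _.
by rewrite ler_wpM2l// dist2_corner.
Qed.

Lemma cell_prob_corner c : `|cell_prob c - corner_mass c| <= osc / M%:R ^+ d.
Proof.
have mc : measurable [set x : T | cell m x = c] by exact: measurable_cell.
have lc : lambda ([set x | cell m x = c] `&` cube) = (M%:R ^- d)%:E.
  by rewrite setIC lebesgue_cell.
have Pfin : P [set x | cell m x = c] \is a fin_num by exact: fin_num_measure.
have up : cell_prob c <= (p (corner R c) + osc) / M%:R ^+ d.
  rewrite -lee_fin /cell_prob fineK// EFinM -lc; apply: (density_le pP) => //.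
  move=> x /= <- cx; rewrite ltW ?p_pos//=.
  by have := osc_cell cx; rewrite ler_norml => /andP[_]; rewrite lerBlDl.
have low : (p (corner R c) - osc) / M%:R ^+ d <= cell_prob c.
  have [neg|pos] := ltP (p (corner R c) - osc) 0.
    apply: (@le_trans _ _ 0); last by rewrite fine_ge0.
    by apply: mulr_le0_ge0; [exact: ltW|rewrite invr_ge0 ltW].
  rewrite -lee_fin /cell_prob fineK// EFinM -lc; apply: (density_ge pP) => //.
  move=> x /= <- cx.
  by have := osc_cell cx; rewrite ler_norml => /andP[+ _]; rewrite lerBrDl addrC.
by rewrite ler_norml /corner_mass; move: low up; rewrite mulrBl mulrDl; lra.
Qed.

Lemma L1dist_piecewise (q : cellT -> R) :
  (L1dist p (fun x => q (cell m x)) <=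
   (osc + l1 corner_mass (fun c => q c / M%:R ^+ d))%:E)%E.
Proof.
apply: (@le_trans _ _ (\int[lambda]_(x in cube)
    (osc + `|p (corner R (cell m x)) - q (cell m x)|)%:E)%E).
  apply: le_integral_nonneg => x cx; rewrite lee_fin//.
  rewrite -(subrKA (p (corner R (cell m x)))).
  by apply: le_trans (ler_normD _ _) _; rewrite lerD2r osc_cell.
rewrite (@integral_finite_valued _ _ _ _ _ (@cell R d m)
  (@measurable_cell R d m) cube (fun c => osc + `|p (corner R c) - q c|)); last first.
- by move=> c; rewrite addr_ge0.
- exact: measurable_cube.
rewrite (eq_bigr (fun c => (osc / M%:R ^+ d +
    `|p (corner R c) - q c| / M%:R ^+ d)%:E)); last first.
  move=> c _; rewrite -mulrDl EFinM; congr (_ * _)%E; exact: lebesgue_cell.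
rewrite sumEFin lee_fin big_split/=; apply: lerD; first exact: sum_cell_le.
apply: ler_sum => c _; rewrite /corner_mass -mulrBl normrM.
by rewrite (gtr0_norm (_ : 0 < M%:R ^- d)) ?invr_gt0.
Qed.

Lemma gibbs_mass_approx : B <= M%:R / (2 ^ d)%:R -> (2 ^ d)%:R / M%:R <= 2^-1 :> R ->
  exists th, l1 corner_mass (gibbs_mass th) <= 2 * B * ((2 ^ d)%:R / M%:R).
Proof.
move=> BM dM.
have [th th_u] := gibbs_approx clique_r
  (fun i j c a b => @log_cross_ratio _ _ _ _ _ _
    pP p_pos p_lip L_ge0 e_irr markov m i j c a b)
  (fun c => le_trans (p_bound (cube_corner R c)).2 BM).
exists th; apply: sum_cell_le => c.
have pc0 : 0 < p (corner R c) by exact/p_pos/cube_corner.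
have g0 : 0 < gibbs R e th c by exact: expR_gt0.
rewrite /corner_mass /gibbs_mass -mulrBl normrM.
rewrite (gtr0_norm (_ : 0 < M%:R ^- d)) ?invr_gt0// ler_pM2r ?invr_gt0//.
(* The logarithmic error is at most 1/2 in absolute value, so [|1 - expR w| <= 2 * |w|]; multiplying
   by [p <= B] gives the bound. *)
pose w := ln (gibbs R e th c) - ln (p (corner R c)).
have wd : `|w| <= (2 ^ d)%:R / M%:R by rewrite distrC; exact: th_u.
have gE : gibbs R e th c = p (corner R c) * expR w.
  by rewrite expRB !lnK ?posrE// mulrC divfK// gt_eqF.
rewrite gE -{1}[p _]mulr1 -mulrBr normrM gtr0_norm// (mulrC 2) -mulrA.
apply: ler_pM; [exact: ltW|by []|exact: (p_bound (cube_corner R c)).1|].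
apply: (@le_trans _ _ (2 * `|w|)); last by rewrite ler_wpM2l.
have w2 : `|w| <= 2^-1 := le_trans wd dM.
have wle : w <= 2^-1 := le_trans (ler_norm _) w2.
have up := expR_le_quadratic wle; have low := expR_ge1Dx w.
have ww : w ^+ 2 <= 2^-1 * `|w|.
  by rewrite -real_normK ?num_real// expr2 ler_wpM2r.
have := ler_norm w; have : - w <= `|w| by rewrite -normrN ler_norm.
by rewrite ler_norml; move: `|w| ww up low => a; lra.
Qed.

(** The 7 counts oscillations: one from [p] to its corner values, one from [corner_mass] to
    [cell_prob], and five from the converse step inside the factor 5 of [min_distance_l1]. The 10 is
    that factor times the 2 of [gibbs_mass_approx]. *)
Lemma estimator_error (z : n.-tuple T) (t : R) : 0 <= t ->
  B <= M%:R / (2 ^ d)%:R -> (2 ^ d)%:R / M%:R <= 2^-1 :> R ->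
  (forall th1 th2 : param,
    let A c := gibbs_mass th2 c < gibbs_mass th1 c in
    `|n%:R^-1 * (\sum_(i < n) (A (cell m (tnth z i)))%:R) -
      fine (P [set x | A (cell m x)])| <= t) ->
  (L1dist p (estimator z) <=
   ((7 * L * d%:R + 10 * B * (2 ^ d)%:R) / M%:R + 4 * t)%:E)%E.
Proof.
move=> t0 BM dM dev.
have [th thB] := gibbs_mass_approx BM dM.
have probE (A : pred cellT) :
    fine (P [set x | A (cell m x)]) = \sum_(c | A c) cell_prob c.
  rewrite -[X in P X]setTI (measure_finite_preimage P (@measurable_cell R d m))//.
  rewrite -sum_fine; last first.
    by move=> c _; rewrite setTI; apply: fin_num_measure; exact: measurable_cell.
  by apply: eq_bigr => c _; rewrite setTI.
have oscE : l1 cell_prob corner_mass <= osc.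
  by apply: sum_cell_le => c; exact: cell_prob_corner.
have main : l1 cell_prob (gibbs_mass (select (sample_cells z))) <=
    5 * l1 cell_prob (gibbs_mass th) + 4 * t.
  apply: min_distance_l1 => // th1 th2; rewrite distrC sum_empirical -probE.
  under eq_bigr do rewrite ffunE.
  exact: dev.
apply: (@le_trans _ _
  (osc + l1 corner_mass (gibbs_mass (select (sample_cells z))))%:E).
  exact: L1dist_piecewise.
rewrite lee_fin.
have := l1_triangle corner_mass cell_prob (gibbs_mass (select (sample_cells z))).
have := l1_triangle cell_prob corner_mass (gibbs_mass th).
rewrite (l1C corner_mass cell_prob).
have -> : (7 * L * d%:R + 10 * B * (2 ^ d)%:R) / M%:R =
  7 * osc + 5 * (2 * B * ((2 ^ d)%:R / M%:R)) by rewrite /osc; field; rewrite gt_eqF.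
move: thB oscE main; generalize osc => o.
have aux (W x1 x2 x3 x4 x5 : R) : x4 <= W -> x2 <= o -> x3 <= 5 * x5 + 4 * t ->
    x5 <= x2 + x4 -> x1 <= x2 + x3 -> o + x1 <= 7 * o + 5 * W + 4 * t by lra.
exact: aux.
Qed.

End estimator.
(** * Rates *)

Lemma powR_root (R : realType) (n s : nat) : (0 < s)%N ->
  ((n%:R : R) `^ (1 / s%:R)) ^+ s = n%:R.
Proof.
move=> s0; rewrite -powR_mulrn ?powR_ge0// -powRrM div1r mulVf ?powRr1//.
by rewrite pnatr_eq0 -lt0n.
Qed.

Lemma powR_root_ge (R : realType) (n s : nat) (c : R) : (0 < s)%N -> 0 <= c ->
  c ^+ s <= n%:R -> c <= n%:R `^ (1 / s%:R).
Proof.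
move=> s0 c0 cn; rewrite -(@ler_pXn2r _ s)// ?nnegrE ?powR_ge0//.
by rewrite powR_root.
Qed.

Section rates.
Context (R : realType) (d r n : nat) (eps : R).
Local Notation A := ((n%:R : R) `^ (1 / (2 + r)%:R)).
Local Notation m := (Num.truncn A).
Local Notation M := m.+1.
Local Notation q := (6 * (2 ^ (d + r))%:R + `|ln (eps / 2)|).
Hypothesis n3 : (3 <= n)%N.
Hypothesis ln1 : 1 <= ln (n%:R : R).
Hypothesis eps0 : 0 < eps.

Lemma root_ge1 : 1 <= A.
Proof. by apply: powR_root_ge => //; rewrite expr1n ler1n; lia. Qed.

Lemma root_lt_mesh : A < M%:R.
Proof. by have /andP[] := truncn_itv (powR_ge0 n%:R (1 / (2 + r)%:R) : 0 <= A). Qed.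

Lemma mesh_le : M%:R <= 2 * A.
Proof.
have /andP[mA _] := truncn_itv (powR_ge0 n%:R (1 / (2 + r)%:R) : 0 <= A).
by rewrite -natr1 mulr_natl mulr2n lerD// root_ge1.
Qed.

(* [q] is chosen so that n t^2 / 8 exceeds twice the logarithm of the number of
   parameters plus ln (2 / eps). *)
Lemma union_bound_small (t : R) : t = 8 * q * (A^-1 * ln n%:R) ->
  (((2 * M ^ 2).+1 ^ (2 ^ d * M ^ r)) ^ 2)%:R *
    (2 * expR (- (n%:R * t ^+ 2 / 8))) <= eps.
Proof.
move=> tE; have A1 := root_ge1; have MA := mesh_le.
set l := ln n%:R in tE *; have l1 : 1 <= l by exact: ln1.
have A0 : 0 < A by apply: lt_le_trans A1.
have nE : n%:R = A ^+ (2 + r) by rewrite powR_root.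
have n0 : 0 < n%:R :> R by rewrite ltr0n; lia.
have q6 : 6 <= q.
  rewrite -[leLHS]addr0 lerD// ler_peMr// ler1n expn_gt0//.
have q0 : 0 < q by apply: lt_le_trans q6.
(* Since [n = A ^+ (2 + r)], the factor [A ^- 2] of [t ^+ 2] leaves exactly the order [A ^+ r] of
   the exponent in the number of parameters. *)
have nt : n%:R * t ^+ 2 / 8 = 8 * q ^+ 2 * (A ^+ r * l ^+ 2).
  have aux (a b c x : R) : 0 < a -> x = a ^+ (2 + r) ->
      x * (8 * c * (a^-1 * b)) ^+ 2 / 8 = 8 * c ^+ 2 * (a ^+ r * b ^+ 2).
    by move=> a0 ->; rewrite exprD; field; rewrite gt_eqF.
  by rewrite tE (aux _ _ _ _ A0 nE).
have N0 : 0 < (2 * M ^ 2).+1%:R :> R by rewrite ltr0n.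
(* [2 * M ^ 2 + 1 <= 9 * A ^+ 2], where [9 <= n ^ 2] and [A ^+ 2 <= n]. *)
have lnN : ln ((2 * M ^ 2).+1%:R : R) <= 3 * l.
  have -> : 3 * l = ln (n%:R ^+ 3) by rewrite lnXn// mulr_natl.
  rewrite ler_ln ?posrE ?exprn_gt0//.
  apply: (@le_trans _ _ (9 * A ^+ 2)).
    rewrite -natr1 natrM natrX.
    have : (M%:R : R) ^+ 2 <= (2 * A) ^+ 2.
      by rewrite lerXn2r ?nnegrE ?ler0n// mulr_ge0// ltW.
    have : 1 <= A ^+ 2 by rewrite exprn_ege1.
    by rewrite exprMn; move: (_ ^+ 2) => M2; lra.
  rewrite [leRHS]exprSr; apply: ler_pM => //.
    by rewrite -natrX ler_nat -[9%N]/(3 ^ 2)%N leq_exp2r.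
  rewrite [leRHS]nE exprD; apply: ler_peMr; last exact: exprn_ege1.
  exact: exprn_ge0 (ltW A0).
have lnN0 : 0 <= ln ((2 * M ^ 2).+1%:R : R) by rewrite ln_ge0// ler1n.
have Mr : (M%:R : R) ^+ r <= (2 ^ r)%:R * A ^+ r.
  by rewrite natrX -exprMn lerXn2r ?nnegrE ?ler0n// mulr_ge0// ltW.
(* The logarithm of the inequality. In [q], the 6 is the 2 of pairs of parameters times the 3 of
   [lnN], and [2 ^ r] comes from [M <= 2 * A]. *)
have main : (2 * (2 ^ d * M ^ r))%:R * ln ((2 * M ^ 2).+1%:R : R) - ln (eps / 2) <=
    8 * q ^+ 2 * (A ^+ r * l ^+ 2).
  have Ar1 : 1 <= A ^+ r by rewrite exprn_ege1.
  have l21 : l <= l ^+ 2 by rewrite expr2 ler_peMl// (le_trans _ l1).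
  have H1 : (2 * (2 ^ d * M ^ r))%:R * ln ((2 * M ^ 2).+1%:R : R) <=
      6 * (2 ^ (d + r))%:R * (A ^+ r * l ^+ 2).
    apply: (@le_trans _ _ (2 * ((2 ^ d)%:R * ((2 ^ r)%:R * A ^+ r)) * (3 * l))).
      apply: ler_pM => //; rewrite natrM natrM.
      do 2!rewrite ler_pM2l ?ltr0n ?expn_gt0//.
      by rewrite natrX.
    have -> : 2 * ((2 ^ d)%:R * ((2 ^ r)%:R * A ^+ r)) * (3 * l) =
      6 * (2 ^ (d + r))%:R * (A ^+ r * l) by rewrite expnD natrM; ring.
    by rewrite ler_pM2l ?mulr_gt0 ?ltr0n ?expn_gt0// ler_pM2l ?exprn_gt0.
  have H2 : - ln (eps / 2) <= `|ln (eps / 2)| * (A ^+ r * l ^+ 2).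
    apply: (@le_trans _ _ `|ln (eps / 2)|); first by rewrite -normrN ler_norm.
    by rewrite ler_peMr// mulr_ege1// (le_trans l1).
  apply: (@le_trans _ _ (q * (A ^+ r * l ^+ 2))).
    by rewrite mulrDl; exact: lerD.
  have X0 : 0 <= A ^+ r * l ^+ 2 by rewrite mulr_ge0 ?sqr_ge0// exprn_ge0// ltW.
  apply: ler_wpM2r => //; rewrite expr2 mulrA ler_peMl ?ltW//; lra.
rewrite nt -expnM (mulnC _ 2%N).
rewrite -ler_ln ?posrE//; last by rewrite !mulr_gt0 ?expR_gt0// ltr0n expn_gt0.
rewrite lnM ?posrE ?mulr_gt0 ?expR_gt0// ?ltr0n ?expn_gt0//.
rewrite lnM ?posrE ?expR_gt0// expRK natrX lnXn//.
rewrite -[X in X + _]mulr_natl.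
have lneps : ln (eps / 2) = ln eps - ln 2 by rewrite ln_div ?posrE.
move: main lneps; move: (8 * _) (_%:R * ln _) => x y.
by move: (ln (eps / 2)) => z; lra.
Qed.

End rates.

(** * The estimator attains the rate *)

Theorem theorem4p8 (R : realType) (d : nat) (e : rel 'I_d)
    (e_sym : symmetric e) (e_irr : irreflexive e) :
  exists V : forall n : nat, n.-tuple (d.-tuple R) -> d.-tuple R -> R,
    (forall n, measurable_fun
       [set: n.-tuple (d.-tuple R) * d.-tuple R] (fun z => V n z.1 z.2)) /\
    forall (p : d.-tuple R -> R) (P : probability (d.-tuple R) R),
      has_density P p -> positive_on_cube p -> lipschitz_on_cube p ->
      markov_property e P ->
      forall (dO : measure_display) (Omega : measurableType dO)
        (Pr : probability Omega R) (X : nat -> {RV Pr >-> d.-tuple R}),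
        iid P X ->
        soft_Op Pr (fun n w => L1dist p (V n [tuple X i w | i < n]))
          (fun n => n%:R `^ (- (1 / (2 + clique_number e)%:R))).
Proof.
pose r := clique_number e.
pose mesh (n : nat) := Num.truncn ((n%:R : R) `^ (1 / (2 + r)%:R)).
exists (fun n => @estimator R d e r (mesh n) n); split.
  by move=> n; exact: measurable_estimator.
move=> p P pP p_pos [L L0 p_lip] markov dO Omega Pr X iidX.
have [B B0 p_bound] := density_bounds p_pos p_lip L0.
have clique_r K : is_clique e K -> (#|K| <= r)%N.
  by move=> cK; exact: (leq_bigmax_cond (F := fun K : {set 'I_d} => #|K|)).
(* A single power of [ln n] is enough. *)
exists 1 => // eps eps0.
pose q : R := 6 * (2 ^ (d + r))%:R + `|ln (eps / 2)|.
pose K : R := 7 * L * d%:R + 10 * B * (2 ^ d)%:R.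
have q0 : 0 < q by rewrite ltr_pwDl// mulr_gt0// ltr0n expn_gt0.
have K0 : 0 <= K by rewrite addr_ge0// !mulr_ge0// ltW.
(* The error bound [K / M + 4 * t] divided by [al]: [1 / M <= al] once [ln n >= 1], and
   [t = 8 * q * al]. *)
exists (K + 4 * (8 * q)); first by rewrite ltr_wpDl// !mulr_gt0.
(* A mesh number of at least [c] meets both conditions of [gibbs_mass_approx]: [B * 2 ^ d <= M] and
   [2 * 2 ^ d <= M]. *)
pose c : R := (B + 2) * (2 ^ d)%:R.
have c0 : 0 <= c by rewrite mulr_ge0// addr_ge0// ltW.
near=> n.
have n3 : (3 <= n)%N by near: n; exact: nbhs_infty_ge.
have ln1 : 1 <= ln (n%:R : R).
  rewrite -[leLHS]expRK ler_ln ?posrE ?expR_gt0// ?ltr0n; last by lia.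
  by near: n; exact: nbhs_infty_ger.
have cn : c ^+ (2 + r) <= n%:R by near: n; exact: nbhs_infty_ger.
set A : R := n%:R `^ (1 / (2 + r)%:R).
have cA : c <= A by exact: powR_root_ge.
have A1 : 1 <= A by exact: root_ge1.
have A0 : 0 < A by apply: lt_le_trans A1.
pose m := mesh n.
have AM : A < m.+1%:R by exact: root_lt_mesh.
have M0 : 0 < m.+1%:R :> R by rewrite ltr0n.
have d0 : 0 < (2 ^ d)%:R :> R by rewrite ltr0n expn_gt0.
have cM : c <= m.+1%:R by rewrite (le_trans cA)// ltW.
have BM : B <= m.+1%:R / (2 ^ d)%:R.
  by rewrite ler_pdivlMr// (le_trans _ cM)// /c ler_pM2r// lerDl.
have dM : (2 ^ d)%:R / m.+1%:R <= 2^-1 :> R.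
  rewrite ler_pdivrMr// ler_pdivlMl// (le_trans _ cM)//.
  by rewrite /c ler_pM2r// lerDr ltW.
pose al := A^-1 * ln n%:R.
have al0 : 0 < al by rewrite mulr_gt0 ?invr_gt0// (lt_le_trans _ ln1).
pose t := 8 * q * al.
have t0 : 0 < t by rewrite /t mulr_gt0// mulr_gt0.
pose b (th : gibbs_param d r m * gibbs_param d r m) (x : d.-tuple R) : bool :=
  gibbs_mass R e th.2 (cell m x) < gibbs_mass R e th.1 (cell m x).
have mb th : measurable [set x | b th x].
  exact: (measurable_finite_preimage (@measurable_cell R d m)
    (fun c => gibbs_mass R e th.2 c < gibbs_mass R e th.1 c)).
pose dev th : set Omega :=
  [set w | t < `|n%:R^-1 * (\sum_(i < n) (b th (X i w))%:R) -
                 fine (P [set x | b th x])|].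
have mdev th : measurable (dev th) by exact: measurable_deviation.
rewrite powRr1; last exact: le_trans ln1.
rewrite powRN -/r -/A -/al -/m.
pose Z w := ((al^-1)%:E * L1dist p (@estimator R d e r m n [tuple X i w | i < n]))%E.
have Zbad : [set w | ((K + 4 * (8 * q))%:E < `|Z w|)%E] `<=`
    [set w | exists th, dev th w].
  move=> w /= Zw; apply: contrapT => /forallNP good.
  have L1w : (L1dist p (@estimator R d e r m n [tuple X i w | i < n]) <=
      (K / m.+1%:R + 4 * t)%:E)%E.
    apply: (estimator_error pP p_pos p_lip L0 p_bound clique_r e_irr markov
      (ltW t0) BM dM).
    move=> th1 th2 /=; rewrite leNgt; apply/negP => bad; apply: (good (th1, th2)).
    have E : \sum_(i < n) (b (th1, th2) (tnth [tuple X i w | i < n] i))%:R =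
        \sum_(i < n) (b (th1, th2) (X i w))%:R :> R.
      by apply: eq_bigr => i _; rewrite tnth_mktuple.
    by rewrite /dev /= -E.
  move: Zw; rewrite ltNge => /negP; apply.
  rewrite gee0_abs; last first.
    apply: mule_ge0; first by rewrite lee_fin invr_ge0 ltW.
    by apply: integral_ge0 => x _; rewrite lee_fin.
  apply: (@le_trans _ _ ((al^-1)%:E * (K / m.+1%:R + 4 * t)%:E)%E).
    by rewrite lee_wpmul2l ?lee_fin ?invr_ge0 ?(ltW al0).
  rewrite -EFinM lee_fin ler_pdivrMl// mulrDr (mulrC al) lerD//.
    rewrite ler_wpM2l//; apply: (@le_trans _ _ A^-1).
      by rewrite lef_pV2 ?posrE// ltW.
    by rewrite ler_peMr// invr_ge0 ltW.
  by rewrite /t [leRHS]mulrC !mulrA.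
(* [Z] depends on the sample through its cells only, hence takes finitely many values. *)
have mZ : measurable [set w | ((K + 4 * (8 * q))%:E < `|Z w|)%E].
  pose h w := sample_cells m [tuple X i w | i < n].
  apply: (@measurable_finite_preimage _ _ _ h _ (fun s => ((K + 4 * (8 * q))%:E <
    `|(al^-1)%:E * L1dist p (fun x => gibbs R e (select R e r s) (cell m x))|)%E)).
  move=> s.
  have ms : measurable [set z : n.-tuple (d.-tuple R) | sample_cells m z = s].
    exact: measurable_sample_cells.
  have mX : measurable_fun setT (fun w => [tuple X i w | i < n]).
    apply/measurable_fun_tnthP => i.
    rewrite (_ : _ \o _ = X i)//.
    by apply/funext => w; rewrite /comp tnth_mktuple.
  by have := mX measurableT _ ms; rewrite setTI.
apply: le_trans (le_measure Pr _ _ Zbad) _.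
- by rewrite inE.
- rewrite inE (_ : mkset _ = \bigcup_(th in setT) dev th).
    by apply: fin_bigcup_measurable => //; exact: finite_finset.
  by apply/seteqP; split => w /= [th]; [exists th|move=> _ ?; exists th].
apply: le_trans (measure_exists_le Pr mdev) _.
apply: (@le_trans _ _ (\sum_(th : gibbs_param d r m * gibbs_param d r m)
  (2 * expR (- (n%:R * t ^+ 2 / 8)))%:E)%E).
  apply: lee_sum => th _.
  exact: (empirical_deviation iidX (ltn_trans _ n3) t0 (mb th)).
rewrite sumEFin lee_fin sumr_const -[leLHS]mulr_natl.
rewrite card_prod card_gibbs_param mulnn.
exact: union_bound_small.
Unshelve. all: by end_near.
Qed.
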